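(* Let $G$ be a connected graph on $n$ vertices. Then $$s^+(G)=n-1 \iff G \text{ is a tree},$$ and $$s^-(G)=n-1 \iff G \text{ is a tree or a complete graph}.$$
   Context: Graphs are finite and simple. For a graph $G$ with adjacency matrix $A$ and adjacency eigenvalues $\lambda_1,\dots,\lambda_n$ (with multiplicity), $s^+(G)=\sum_{\lambda_i>0}\lambda_i^2$ and $s^-(G)=\sum_{\lambda_i<0}\lambda_i^2$. The graph $K_1$ counts as both a tree and a complete graph. *)

(* Defs.v *)
From mathcomp Require Import all_boot all_order all_algebra.
From mathcomp Require Import reals polyrcf.

Set Implicit Arguments.
Unset Strict Implicit.
Unset Printing Implicit Defensive.

Import Order.TTheory GRing.Theory Num.Theory.
Local Open Scope ring_scope.

Record simple_graph (T : finType) := SimpleGraph {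
  adj :> rel T;
  adj_sym : symmetric adj;
  adj_irrefl : irreflexive adj
}.

(* The graph with no vertices is not connected. *)
Definition connected_graph (T : finType) (G : simple_graph T) : Prop :=
  (0 < #|T|)%N /\ forall x y : T, connect G x y.

(* A cycle has at least three vertices; [ucycle] also holds of shorter
   sequences, e.g. of the two ends of an edge. *)
Definition acyclic_graph (T : finType) (G : simple_graph T) : Prop :=
  forall c : seq T, (2 < size c)%N -> ~ ucycle G c.

Definition is_tree (T : finType) (G : simple_graph T) : Prop :=
  connected_graph G /\ acyclic_graph G.

Definition is_complete (T : finType) (G : simple_graph T) : Prop :=
  forall x y : T, x != y -> G x y.

Definition adjacency_matrix (R : realType) (T : finType) (G : simple_graph T) :
  'M[R]_#|T| := \matrix_(i, j) (G (enum_val i) (enum_val j))%:R.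

(* The real eigenvalues, each repeated according to its algebraic
   multiplicity; [rootsR] lists each root once. *)
Definition spectrum (R : realType) (n : nat) (A : 'M[R]_n) : seq R :=
  flatten [seq nseq (mup x (char_poly A)) x | x <- rootsR (char_poly A)].

Definition splus (R : realType) (T : finType) (G : simple_graph T) : R :=
  \sum_(x <- spectrum (adjacency_matrix R G) | 0 < x) x ^+ 2.

Definition sminus (R : realType) (T : finType) (G : simple_graph T) : R :=
  \sum_(x <- spectrum (adjacency_matrix R G) | x < 0) x ^+ 2.

(* Main.v *)
(* Write [A = M - N] with [M], [N] positive semidefinite and [M N = 0], so that
   [s^+ = tr M^2], [s^- = tr N^2], and let [m] be the number of edges. For a
   correlation matrix [C] (positive semidefinite, unit diagonal) the Schur product
   theorem gives [sum C_ij M_ij^2 >= 0]; as the rows of [M] and [N] are orthogonal and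
   [M], [N] agree off the edges, this yields
     [tr M^2 <= sum 1 / (1 - C_ij)]  over the ordered edges [ij],
   and likewise for [N]. Every connected graph has a [C] for which the right-hand side
   is at most [2m - (n - 1)]. This is proved by induction on [n]: correlation matrices
   are glued along a cut vertex [v] by [C_ij = C_iv C_vj], and if there is no cut
   vertex one takes [C_ij = (n - 1)^-1 * sum_(w <> i, j) C^w_ij], with [C^w] given by
   induction on [G - w]. Hence [s^+, s^- >= n - 1] since [s^+ + s^- = 2m].
   The averaging step is strict unless [G] is complete. When blocks are glued, equality
   forces [M_ij = 0] whenever [ij] is not an edge and [C_ij < 1]; comparing the entries
   of [M^2] and [M A] across a cut vertex of a cycle then shows that [M] has a zero on
   its diagonal in a nonzero row. *)

Require Import Defs.
From mathcomp Require Import all_boot all_order all_algebra.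
From mathcomp Require Import reals.
From mathcomp Require Import polyrcf complex.
From mathcomp Require Import ring lra.

Set Implicit Arguments.
Unset Strict Implicit.
Unset Printing Implicit Defensive.

Import Order.TTheory GRing.Theory Num.Theory.
Local Open Scope ring_scope.

(** * Spectral decomposition of real symmetric matrices *)

Lemma char_poly_uconj (F : fieldType) n (P A : 'M[F]_n) : P \in unitmx ->
  char_poly (invmx P *m A *m P) = char_poly A.
Proof.
move=> uP; rewrite /char_poly /char_poly_mx !map_mxM /=.
have uQ : map_mx polyC (invmx P) *m map_mx polyC P = 1%:M.
  by rewrite -map_mxM mulVmx // map_mx1.
have -> : 'X%:M - map_mx polyC (invmx P) *m map_mx polyC A *m map_mx polyC P =
    map_mx polyC (invmx P) *m ('X%:M - map_mx polyC A) *m map_mx polyC P.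
  by rewrite mulmxBr mulmxBl -(mulmxA _ 'X%:M) -(scalar_mxC 'X) mulmxA uQ mul1mx.
by rewrite !det_mulmx mulrC mulrA -det_mulmx mulmx1C // det1 mul1r.
Qed.

(** The matrix is hermitian over [R[i]], so the spectral theorem for normal matrices applies and the
    eigenvalues are real. [P] stays complex, which suffices: identities between polynomials in [A],
    their traces and the characteristic polynomial descend to [R]. *)
Lemma symmetric_diagonalizable (R : rcfType) n (A : 'M[R]_n) : A^T = A ->
  exists (P : 'M[R[i]]_n) (d : 'rV[R]_n), P \in unitmx /\
    map_mx (real_complex R) A = invmx P *m diag_mx (map_mx (real_complex R) d) *m P.
Proof.
move=> symA; set B := map_mx _ A.
have symB : B \is symmetricmx.
  by apply/is_hermitianmxP; rewrite expr0 scale1r map_mx_id // map_trmx symA.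
have realB : B \is a mxOver Num.real.
  by apply/mxOverP => i j; rewrite mxE complex_real.
have [/hermitian_normalmx nB reald] :
  B \is hermsymmx /\ spectral_diag B \is a mxOver Num.real.
  by split; last apply: hermitian_spectral_diag_real; apply: realsym_hermsym.
exists (spectralmx B), (map_mx (@complex.Re R) (spectral_diag B)).
split; first exact: spectral_unit.
rewrite -map_mx_comp map_mx_id_in; first exact/orthomx_spectralP.
by move=> i j; apply: RRe_real; apply/mxOverP.
Qed.

Section Diagonalization.
Variables (R : rcfType) (n : nat) (A : 'M[R]_n.+1).
Variables (P : 'M[R[i]]_n.+1) (d : 'rV[R]_n.+1).
Hypothesis uP : P \in unitmx.
Hypothesis AE :
  map_mx (real_complex R) A = invmx P *m diag_mx (map_mx (real_complex R) d) *m P.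

Let inj_C : injective (map_poly (real_complex R)) := map_inj_poly (@complexI R) (erefl 0).

Lemma char_poly_diagonalized : char_poly A = \prod_i ('X - (d 0 i)%:P).
Proof.
apply: inj_C; rewrite map_char_poly AE char_poly_uconj //.
rewrite char_poly_trig ?diag_mx_is_trig // rmorph_prod; apply: eq_bigr => i _ /=.
by rewrite !mxE eqxx mulr1n rmorphB /= map_polyX map_polyC.
Qed.

Lemma horner_diagonalized (f : {poly R}) : map_mx (real_complex R) (horner_mx A f) =
  invmx P *m diag_mx (map_mx (real_complex R \o horner f) d) *m P.
Proof.
rewrite map_horner_mx AE horner_mx_uconjC // horner_mx_diag; congr (_ *m diag_mx _ *m _).
by apply/rowP => i; rewrite !mxE horner_map.
Qed.

Lemma eq_horner_diagonalized (f g : {poly R}) :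
  (forall i, f.[d 0 i] = g.[d 0 i]) -> horner_mx A f = horner_mx A g.
Proof.
move=> fg; apply: (map_mx_inj (f := real_complex R)); rewrite !horner_diagonalized.
by congr (_ *m diag_mx _ *m _); apply/rowP => i; rewrite !mxE /= fg.
Qed.

Lemma trace_horner_diagonalized (f : {poly R}) :
  \tr (horner_mx A f) = \sum_i f.[d 0 i].
Proof.
apply: (@complexI R); rewrite -trace_map_mx horner_diagonalized.
rewrite mxtrace_mulC mulmxA mulmxV // mul1mx mxtrace_diag rmorph_sum.
by apply: eq_bigr => i _; rewrite mxE.
Qed.

(** By [char_poly_diagonalized], [mup x] counts the occurrences of [x] among the entries of [d], so
    the flattened list is a permutation of them. *)
Lemma sum_spectrum_diagonalized (p : pred R) (g : R -> R) :
  \sum_(x <- flatten [seq nseq (mup x (char_poly A)) x | x <- rootsR (char_poly A)]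
     | p x) g x = \sum_(i | p (d 0 i)) g (d 0 i).
Proof.
rewrite char_poly_diagonalized -(big_map (d 0) xpredT (fun x => 'X - x%:P)).
set s := map (d 0) _; set q := \prod_(x <- s) ('X - x%:P).
have q0 : q != 0 by rewrite monic_neq0 // monic_prod_XsubC.
rewrite -(big_map (d 0) p g) -/s; apply: perm_big.
have -> : [seq nseq (mup x q) x | x <- rootsR q] =
    [seq nseq (count_mem x s) x | x <- rootsR q].
  by apply: eq_map => x; rewrite /q mu_prod_XsubC.
have rE x : (x \in rootsR q) = (x \in s).
  by rewrite -(roots_on_rootsR q0) /q root_prod_XsubC.
apply: perm_trans (perm_count_undup s).
apply/perm_flatten/perm_map/uniq_perm; rewrite ?undup_uniq ?uniq_roots // => x.
by rewrite mem_undup rE.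
Qed.
End Diagonalization.

(** Newton interpolation: a new node is corrected by a multiple of the polynomial vanishing at the
    earlier ones. It serves to write square roots on the spectrum as polynomials. *)
Lemma interpolation (F : fieldType) (g : F -> F) (s : seq F) :
  exists f : {poly F}, forall x, x \in s -> f.[x] = g x.
Proof.
elim: s => [|a s [f fP]]; first by exists 0.
have [as_|nas] := boolP (a \in s).
  by exists f => x; rewrite inE => /predU1P[->|]; apply: fP.
pose q := \prod_(b <- s) ('X - b%:P).
have q0 : q.[a] != 0 by rewrite -/(root q a) root_prod_XsubC.
exists (f + ((g a - f.[a]) / q.[a]) *: q) => x.
rewrite inE hornerD hornerZ => /predU1P[->|xs]; first by rewrite divfK // addrC subrK.
have /eqP-> : root q x by rewrite root_prod_XsubC.
by rewrite mulr0 addr0 fP.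
Qed.

Lemma horner_mx_sym (F : comNzRingType) n (A : 'M[F]_n.+1) (f : {poly F}) : A^T = A ->
  (horner_mx A f)^T = horner_mx A f.
Proof.
move=> symA; elim/poly_ind: f => [|f c IH]; first by rewrite rmorph0 trmx0.
rewrite rmorphD rmorphM /= horner_mx_X horner_mx_C linearD /= tr_scalar_mx.
congr (_ + _); rewrite -[X in X^T]/(horner_mx A f *m A) trmx_mul IH symA.
exact/esym/comm_horner_mx.
Qed.

(* [W] and [Z] are polynomials in [A], so that real eigenvectors are not needed. *)
Lemma spectral_split (R : realType) n (A : 'M[R]_n) : A^T = A ->
  exists W Z : 'M[R]_n, [/\ W^T = W, Z^T = Z,
    A = W *m W - Z *m Z, W *m W *m (Z *m Z) = 0 &
    \tr ((W *m W) *m (W *m W)) = \sum_(x <- spectrum A | 0 < x) x ^+ 2 /\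
    \tr ((Z *m Z) *m (Z *m Z)) = \sum_(x <- spectrum A | x < 0) x ^+ 2].
Proof.
case: n A => [|n] A symA.
  exists 0, 0; rewrite !trmx0 !mul0mx subr0 mxtrace0; split=> //.
    exact: flatmx0.
  by rewrite /spectrum [char_poly _]det_mx00 rootsRC !big_nil.
have [P [d [uP AE]]] := symmetric_diagonalizable symA.
(* [Num.sqrt] is 0 on negative reals, so these are the square roots of the positive and the negative
   part of [x], and their product is 0. *)
pose pos (x : R) := Num.sqrt x; pose neg (x : R) := Num.sqrt (- x).
have [f fP] := interpolation pos (codom (d 0)).
have [g gP] := interpolation neg (codom (d 0)).
have {}fP i : f.[d 0 i] = pos (d 0 i) by rewrite fP ?codom_f.
have {}gP i : g.[d 0 i] = neg (d 0 i) by rewrite gP ?codom_f.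
have sqf i : pos (d 0 i) * pos (d 0 i) = if 0 < d 0 i then d 0 i else 0.
  rewrite -expr2 /pos; case: ltP => [h|h]; last by rewrite ler0_sqrtr ?expr0n.
  by rewrite sqr_sqrtr // ltW.
have sqg i : neg (d 0 i) * neg (d 0 i) = if d 0 i < 0 then - d 0 i else 0.
  rewrite -expr2 /neg; case: ltP => [h|h]; last by rewrite ler0_sqrtr ?expr0n // oppr_le0.
  by rewrite sqr_sqrtr // oppr_ge0 ltW.
exists (horner_mx A f), (horner_mx A g).
rewrite !horner_mx_sym // -![_ *m _]/(_ * _) -!rmorphM /= -rmorphB /=.
split=> //.
- rewrite -[LHS]horner_mx_X; apply: (eq_horner_diagonalized uP AE) => i.
  rewrite hornerX hornerD hornerN !hornerM fP gP sqf sqg.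
  by case: ltgtP => [h|h|h]; rewrite ?subr0 ?sub0r ?opprK -?h.
- rewrite -[RHS](rmorph0 (horner_mx A)); apply: (eq_horner_diagonalized uP AE) => i.
  rewrite !hornerM fP gP sqf sqg horner0.
  by case: ltgtP => [h|h|h]; rewrite ?mul0r ?mulr0.
rewrite !(trace_horner_diagonalized uP AE) /spectrum.
rewrite !(sum_spectrum_diagonalized uP AE) [in RHS]big_mkcond /=.
rewrite [in X in _ /\ (_ = X)]big_mkcond /=.
split; apply: eq_bigr => i _; rewrite !hornerM ?fP ?gP ?sqf ?sqg; case: ifP => _;
  by rewrite ?mulr0 ?mulrNN ?expr2.
Qed.

(** * Connectivity and cut vertices *)

Section VertexCuts.
Variables (T : finType) (G : simple_graph T).
Implicit Types (S K L : {set T}) (v w : T).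

(** Connectedness of the subgraph induced on [S], by edges leaving each proper nonempty part instead
    of by paths; this form restricts easily to the sides of a cut, and a failure directly provides
    one. *)
Definition conn S := (S != set0) &&
  [forall K : {set T}, (K \proper S) && (K != set0) ==>
     [exists x in K, exists y in S :\: K, G x y]].

Lemma connP S : reflect (S != set0 /\ forall K, K \proper S -> K != set0 ->
    exists x y, [/\ x \in K, y \in S, y \notin K & G x y]) (conn S).
Proof.
apply: (iffP andP) => -[S0 H]; split=> //.
  move=> K pK K0; move/forallP/(_ K): H; rewrite pK K0 /=.
  by case/exists_inP => x xK /exists_inP[y /setDP[yS yK] xy]; exists x, y.
apply/forallP => K; apply/implyP => /andP[pK K0].
have [x [y [xK yS yK xy]]] := H K pK K0.
by apply/exists_inP; exists x => //; apply/exists_inP; exists y; rewrite // inE yK.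
Qed.

(** The two sides meet only in [v]. They may be empty; [v] is a genuine cut vertex of a connected
    [S] when both are nonempty. *)
Record cut S v K L : Prop := Cut {
  cutE : S = v |: (K :|: L);
  cut_vl : v \notin K;
  cut_vr : v \notin L;
  cut_disj : [disjoint K & L];
  cut_nadj : forall i j, i \in K -> j \in L -> ~~ G i j }.

Lemma cut_sym S v K L : cut S v K L -> cut S v L K.
Proof.
case=> -> vK vL d n; split=> //; first by rewrite (setUC K).
  by rewrite disjoint_sym.
by move=> i j iL jK; rewrite adj_sym n.
Qed.

Section Cut.
Variables (S : {set T}) (v : T) (K L : {set T}).
Hypothesis cS : cut S v K L.

Lemma cutF i : i \in K -> i \in L = false.
Proof. exact: disjointFr (cut_disj cS). Qed.

Lemma cut_card : (#|v |: K| + #|v |: L| = #|S|.+1)%N.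
Proof.
have [-> vK vL d _] := cS.
rewrite !cardsU1 in_setU negb_or vK vL /= cardsU disjoint_setI0 // cards0 subn0.
by rewrite !add1n addSn addnS.
Qed.

Lemma cut_subl : v |: K \subset S.
Proof. by rewrite (cutE cS) setUS // subsetUl. Qed.

Lemma cut_ltl : L != set0 -> (#|v |: K| < #|S|)%N.
Proof.
rewrite -cards_eq0 -lt0n => L0; have := cut_card.
by rewrite (cardsU1 _ L) (cut_vr cS) add1n addnS => -[<-]; rewrite -addn1 leq_add2l.
Qed.

Lemma cut_adj : conn S -> K != set0 -> exists2 a, a \in K & G a v.
Proof.
move=> /connP[_ cn] K0.
have pK : K \proper S.
  rewrite properE (subset_trans (subsetUr _ _) cut_subl) /=.
  by apply/subsetPn; exists v; rewrite ?(cut_vl cS) // (cutE cS) setU11.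
have [x [y [xK yS yK xy]]] := cn K pK K0; exists x => //.
move: yS; rewrite (cutE cS) !inE (negPf yK) /= => /orP[/eqP<- //|yL].
by move: xy; rewrite (negPf (cut_nadj cS xK yL)).
Qed.

(** If [v] is in [X], take an edge of [S] leaving [X :|: L]: it ends in [K], so it cannot start in
    [L]. Otherwise [X] lies in [K], and an edge leaving [X] cannot end in [L]. *)
Lemma cut_conn : conn S -> conn (v |: K).
Proof.
move=> /connP[_ cn]; apply/connP; split.
  by apply/set0Pn; exists v; rewrite setU11.
move=> X pX X0.
have [vX|vX] := boolP (v \in X).
  have [XK [z zK zX]] := properP pX.
  have [| | x [y [xX yS]]] := cn (X :|: L).
  - apply/properP; split.
      rewrite subUset (subset_trans XK cut_subl) (cutE cS) setUA subsetUr //.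
    exists z; first exact: (subsetP cut_subl).
    rewrite inE (negPf zX) /=; apply/negP.
    move: zK; rewrite !inE => /predU1P[->|/cutF->//]; apply/negP; exact: cut_vr cS.
  - by apply/set0Pn; exists v; rewrite inE vX.
  rewrite inE negb_or => /andP[yX yL] xy.
  have yK : y \in K.
    move: yS; rewrite (cutE cS) !inE (negPf yL) orbF => /predU1P[yv|//].
    by rewrite yv vX in yX.
  exists x, y; split=> //; last by rewrite !inE yK orbT.
  move: xX; rewrite inE => /orP[//|xL].
  by move: xy; rewrite adj_sym (negPf (cut_nadj cS yK xL)).
have XK : X \subset K.
  apply/subsetP => z zX; have /subsetP/(_ z zX) := proper_sub pX.
  by rewrite !inE => /predU1P[zv|//]; rewrite zv (negPf vX) in zX.
have [| x [y [xX yS yX xy]]] := cn X _ X0.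
  by rewrite (proper_sub_trans pX) // cut_subl.
exists x, y; split=> //; move: yS; rewrite (cutE cS) !inE.
case/or3P=> [->//|->|yL]; first by rewrite orbT.
by move: xy; rewrite (negPf (cut_nadj cS (subsetP XK _ xX) yL)).
Qed.

End Cut.

Lemma disconnected_cut S v : v \in S -> S :\ v != set0 -> ~~ conn (S :\ v) ->
  exists K L, [/\ cut S v K L, K != set0 & L != set0].
Proof.
move=> vS S0; rewrite /conn S0 /= => /forallPn[K].
rewrite negb_imply => /andP[/andP[pK K0]] /exists_inPn nK.
have [KS [z zS zK]] := properP pK.
exists K, (S :\ v :\: K); split=> //; last by apply/set0Pn; exists z; rewrite inE zK.
split.
- apply/setP => x; have := subsetP KS x; rewrite !inE.
  by case: eqVneq => [->|_]; case: (x \in K) => //= ->.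
- by apply/negP => /(subsetP KS); rewrite !inE eqxx.
- by rewrite !inE eqxx andbF.
- by rewrite -setI_eq0; apply/eqP/setP => x; rewrite !inE; case: (x \in K).
move=> i j iK jL; have := nK i iK; apply: contra => ij.
by apply/exists_inP; exists j.
Qed.

(** [L] is attached at [v], and [v] is [w] or lies in [L']; hence adding [L] to the side [L']
    creates no edge to [K']. *)
Lemma cut_extend S v K L w K' L' : cut S v K L -> cut (v |: K) w K' L' ->
  v \notin K' -> cut S w K' (L' :|: L).
Proof.
move=> cS c' vK'.
have memE x : (x \in K') || (x \in L') || (x == w) = (x == v) || (x \in K).
  by move: (cutE c') => /setP/(_ x); rewrite !inE => ->; rewrite orbC.
have K'K x : x \in K' -> x \in K.
  move=> xK'; have := memE x; rewrite xK' /=.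
  by case: eqVneq => [xv|//]; rewrite xv (negPf vK') in xK'.
have nL x : (x == v) || (x \in K) -> x \in L = false.
  by case/predU1P=> [->|/(cutF cS)//]; exact/negbTE/(cut_vr cS).
split.
- apply/setP => x; rewrite (cutE cS) !inE orbA -memE.
  by case: (x == w); case: (x \in K'); case: (x \in L').
- exact: cut_vl c'.
- by rewrite inE negb_or (cut_vr c') nL // -memE eqxx orbT.
- rewrite -setI_eq0; apply/eqP/setP => x; rewrite !inE.
  by case xK': (x \in K') => //=; rewrite (cutF c' xK') (cutF cS (K'K x xK')).
move=> i j iK'; rewrite inE => /orP[jL'|jL]; first exact: (cut_nadj c' iK' jL').
exact: (cut_nadj cS (K'K i iK') jL).
Qed.

End VertexCuts.

(** * Correlation matrices *)

Section SumsOverSets.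
Variables (T : finType) (V : nmodType).
Implicit Types (S : {set T}) (F : T -> T -> V).

Lemma sum_subset (S A : {set T}) (f : T -> V) : A \subset S ->
  \sum_(i in S) (if i \in A then f i else 0) = \sum_(i in A) f i.
Proof.
move=> AS; rewrite -big_mkcondr; apply: eq_bigl => i.
by rewrite andb_idl //; apply: (subsetP AS).
Qed.

Lemma sum2_subset (S A : {set T}) F : A \subset S ->
  \sum_(i in S) \sum_(j in S) (if (i \in A) && (j \in A) then F i j else 0) =
  \sum_(i in A) \sum_(j in A) F i j.
Proof.
move=> AS; rewrite -(sum_subset _ AS); apply: eq_bigr => i _.
by case: ifP => _ /=; [rewrite -(sum_subset _ AS) | rewrite big1].
Qed.

(** Double counting that turns sums of averaged entries into sums over the vertex-deleted sets
    [S :\ w]. *)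
Lemma sum_avoiding S (P : rel T) (H : T -> T -> T -> V) :
  \sum_(i in S) \sum_(j in S | P i j) \sum_(w in S | (w != i) && (w != j)) H w i j =
  \sum_(w in S) \sum_(i in S :\ w) \sum_(j in S :\ w | P i j) H w i j.
Proof.
under eq_bigr => i _ do under eq_bigr => j _ do rewrite big_mkcondr.
under eq_bigr => i _ do rewrite exchange_big /=.
rewrite exchange_big /=; apply: eq_bigr => w _.
rewrite [RHS](eq_bigl (fun i => (i \in S) && (w != i))); last first.
  by move=> i; rewrite !inE andbC eq_sym.
rewrite big_mkcondr /=; apply: eq_bigr => i _; case: ifP => wi; last by rewrite big1.
rewrite [RHS](eq_bigl (fun j => ((j \in S) && P i j) && (w != j))); last first.
  by move=> j; rewrite !inE (eq_sym w); case: (j != w); rewrite ?andbT ?andbF.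
by rewrite [RHS]big_mkcondr.
Qed.

End SumsOverSets.

Section Correlation.
Variables (R : realFieldType) (T : finType).
Implicit Types (S : {set T}) (C : T -> T -> R).

Definition psd S C := forall x : T -> R,
  0 <= \sum_(i in S) \sum_(j in S) x i * x j * C i j.

Record corr S C : Prop := Corr {
  corr_psd : psd S C;
  corr_sym : forall i j, i \in S -> j \in S -> C i j = C j i;
  corr_diag : forall i, i \in S -> C i i = 1 }.

Lemma sum_delta S (i : T) (f : T -> R) : i \in S ->
  \sum_(k in S) (k == i)%:R * f k = f i.
Proof.
move=> iS; rewrite (bigD1 i) //= eqxx mul1r big1 ?addr0 // => k /andP[_ /negPf->].
by rewrite mul0r.
Qed.

Lemma psd_shift S C (x : T -> R) (i : T) (a : R) : corr S C -> i \in S ->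
  \sum_(k in S) \sum_(l in S) (x k + a * (k == i)%:R) * (x l + a * (l == i)%:R) * C k l =
  \sum_(k in S) \sum_(l in S) x k * x l * C k l
    + 2 * a * (\sum_(k in S) x k * C k i) + a ^+ 2.
Proof.
move=> cC iS.
pose d (k : T) : R := (k == i)%:R.
transitivity (\sum_(k in S) (\sum_(l in S) x k * x l * C k l + a * (x k * C k i)
    + a * (d k * (\sum_(l in S) x l * C k l)) + a ^+ 2 * (d k * C k i))).
  apply: eq_bigr => k kS.
  rewrite -(sum_delta (fun l => x k * C k l) iS) -(sum_delta (fun l => C k l) iS).
  rewrite !mulr_sumr -!big_split /=; apply: eq_bigr => l _; rewrite /d; ring.
rewrite !big_split /= -!mulr_sumr !sum_delta // (corr_diag cC) //.
under [X in _ + a * X + _]eq_bigr => l lS do rewrite (corr_sym cC iS lS).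
ring.
Qed.

(** The quadratic form is nonnegative at [e_i + e_j] and at [e_i - e_j]. *)
Lemma corr_normr_le1 S C i j : corr S C -> i \in S -> j \in S -> `|C i j| <= 1.
Proof.
move=> cC iS jS.
have H (a : R) : 0 <= 1 + 2 * a * C i j + a ^+ 2.
  have /= := corr_psd cC (fun k => (k == i)%:R + a * (k == j)%:R).
  rewrite psd_shift // sum_delta //.
  under eq_bigr => k _ do under eq_bigr => l _ do rewrite -mulrA.
  under eq_bigr => k _ do rewrite -mulr_sumr sum_delta //.
  by rewrite sum_delta // (corr_diag cC).
rewrite ler_norml; apply/andP; split.
  have := H 1; rewrite expr1n; lra.
have := H (-1); rewrite sqrrN expr1n; lra.
Qed.

Lemma corr_le1 S C i j : corr S C -> i \in S -> j \in S -> C i j <= 1.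
Proof. by move=> cC iS jS; apply: le_trans (ler_norm _) (corr_normr_le1 cC iS jS). Qed.

(* The quadratic form at [x], shifted along [v] so as to kill its correlation with [v]. *)
Lemma corr_schur_complement S C v (x : T -> R) : corr S C -> v \in S ->
  (\sum_(i in S) x i * C i v) ^+ 2 <= \sum_(i in S) \sum_(j in S) x i * x j * C i j.
Proof.
move=> cC vS; set a := \sum_(i in S) x i * C i v.
have /= := corr_psd cC (fun k => x k + (- a) * (k == v)%:R).
rewrite psd_shift // -/a -addrA (_ : 2 * - a * a + (- a) ^+ 2 = - a ^+ 2); last by ring.
by rewrite subr_ge0.
Qed.

(** Schur product theorem for the entrywise square of [W^2]: expanding the square over pairs [k, l]
    gives the quadratic form of [C] at the vectors [i |-> W i k * W i l]. *)
Lemma psd_entrywise_square S C (W : T -> T -> R) :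
  psd S C -> (forall i j, W i j = W j i) ->
  0 <= \sum_(i in S) \sum_(j in S) (\sum_k W i k * W k j) ^+ 2 * C i j.
Proof.
move=> pC symW.
have -> : \sum_(i in S) \sum_(j in S) (\sum_k W i k * W k j) ^+ 2 * C i j =
    \sum_k \sum_l \sum_(i in S) \sum_(j in S) (W i k * W i l) * (W j k * W j l) * C i j.
  rewrite [RHS](eq_bigr (fun k => \sum_(i in S) \sum_(j in S)
      \sum_l (W i k * W i l) * (W j k * W j l) * C i j)); last first.
    move=> k _; rewrite exchange_big /=; apply: eq_bigr => i _.
    by rewrite exchange_big.
  rewrite [RHS]exchange_big /=; apply: eq_bigr => i _.
  rewrite exchange_big /=; apply: eq_bigr => j _.
  rewrite expr2 mulr_suml mulr_suml; apply: eq_bigr => k _.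
  rewrite mulr_sumr mulr_suml; apply: eq_bigr => l _.
  by rewrite (symW k) (symW l); ring.
by apply: sumr_ge0 => k _; apply: sumr_ge0 => l _; apply: pC.
Qed.

(* [C1] on [v |: K], [C2] on [v |: L] and [C1 i v * C2 v j] across: a rank-one matrix
   plus the Schur complements of the diagonal entry at [v] in [C1] and in [C2]. *)
Definition glue v K L C1 C2 (i j : T) : R :=
  let c k := if k \in v |: K then C1 k v else C2 k v in
  c i * c j
    + (if (i \in v |: K) && (j \in v |: K) then C1 i j - C1 i v * C1 j v else 0)
    + (if (i \in v |: L) && (j \in v |: L) then C2 i j - C2 i v * C2 j v else 0).

Section Glue.
Variables (G : simple_graph T) (S : {set T}) (v : T) (K L : {set T}).
Variables (C1 C2 : T -> T -> R).
Hypotheses (cS : cut G S v K L) (cC1 : corr (v |: K) C1) (cC2 : corr (v |: L) C2).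
Local Notation C := (glue v K L C1 C2).

Let vK : v \in v |: K. Proof. by rewrite setU11. Qed.
Let vL : v \in v |: L. Proof. by rewrite setU11. Qed.

Let inKL i : i \in v |: K -> i \in v |: L -> i = v.
Proof.
rewrite !inE => /predU1P[//|iK] /predU1P[//|iL].
by rewrite (cutF cS iK) in iL.
Qed.

Lemma glue_left i j : i \in v |: K -> j \in v |: K -> C i j = C1 i j.
Proof.
move=> iK jK; rewrite /glue iK jK /=; case: ifP => [/andP[iL jL]|_]; last by ring.
by rewrite (inKL iK iL) (inKL jK jL) (corr_diag cC1 vK) (corr_diag cC2 vL); ring.
Qed.

Lemma glue_right i j : i \in v |: L -> j \in v |: L -> C i j = C2 i j.
Proof.
move=> iL jL; rewrite /glue iL jL /=.
have cE k : k \in v |: L -> (if k \in v |: K then C1 k v else C2 k v) = C2 k v.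
  by case: ifP => // kK kL; rewrite (inKL kK kL) (corr_diag cC1 vK) (corr_diag cC2 vL).
rewrite !cE //; case: ifP => [/andP[iK jK]|_]; last by ring.
by rewrite (inKL iK iL) (inKL jK jL) (corr_diag cC1 vK) (corr_diag cC2 vL); ring.
Qed.

Lemma glue_across i j : i \in K -> j \in L -> C i j = C1 i v * C2 j v.
Proof.
move=> iK jL; have iK' : i \in v |: K by rewrite inE iK orbT.
have jK : j \in v |: K = false.
  apply/negP; rewrite inE => /orP[/set1P jv|jK]; last by rewrite (cutF cS jK) in jL.
  by have := cut_vr cS; rewrite -jv jL.
have iL : i \in v |: L = false.
  apply/negP; rewrite inE => /orP[/set1P iv|iL]; last by rewrite (cutF cS iK) in iL.
  by have := cut_vl cS; rewrite -iv iK.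
by rewrite /glue iK' jK iL /= !addr0.
Qed.

Lemma corr_glue : corr S C.
Proof.
have K1 := cut_subl cS; have L1 := cut_subl (cut_sym cS).
have cases i : i \in S -> (i \in v |: K) || (i \in v |: L).
  by rewrite (cutE cS) !inE => /or3P[] ->; rewrite ?orbT.
split=> [x|i j _ _|i /cases /orP[iK|iL]].
- pose c k := if k \in v |: K then C1 k v else C2 k v.
  rewrite (eq_bigr (fun i => \sum_(j in S) ((x i * c i) * (x j * c j) +
    ((if (i \in v |: K) && (j \in v |: K)
        then x i * x j * C1 i j - (x i * C1 i v) * (x j * C1 j v) else 0)
    + (if (i \in v |: L) && (j \in v |: L)
        then x i * x j * C2 i j - (x i * C2 i v) * (x j * C2 j v) else 0)))));
    last first.
    move=> i _; apply: eq_bigr => j _; rewrite /glue -/(c i) -/(c j).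
    by do 2![case: ifP => _]; ring.
  under eq_bigr => i _ do rewrite 2!big_split.
  rewrite /= 2!big_split /= !sum2_subset //.
  have sq (A : {set T}) (C' : T -> T -> R) : corr A C' -> v \in A ->
    0 <= \sum_(i in A) \sum_(j in A) (x i * x j * C' i j - (x i * C' i v) * (x j * C' j v)).
    move=> cC' vA; under eq_bigr => i _ do rewrite sumrB -mulr_sumr.
    rewrite sumrB -mulr_suml -expr2 subr_ge0; exact: corr_schur_complement.
  rewrite !addr_ge0 ?sq //.
  under eq_bigr => i _ do rewrite -mulr_sumr.
  by rewrite -mulr_suml -expr2 sqr_ge0.
- rewrite /glue (andbC (j \in v |: K)) (andbC (j \in v |: L)) (mulrC (if j \in _ then _ else _)).
  congr (_ + _ + _); case: ifP => // /andP[iA jA]; rewrite mulrC.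
    by rewrite (corr_sym cC1).
  by rewrite (corr_sym cC2).
- by rewrite glue_left // (corr_diag cC1).
- by rewrite glue_right // (corr_diag cC2).
Qed.

End Glue.
End Correlation.

(** * The cost of a correlation matrix *)

Section EdgeCost.
Variables (R : realFieldType) (T : finType) (G : simple_graph T).
Implicit Types (S K L : {set T}) (C : T -> T -> R).

Definition arc_sum S (F : T -> T -> R) : R := \sum_(i in S) \sum_(j in S | G i j) F i j.
Definition arcs S : R := arc_sum S (fun _ _ => 1).
Definition cost S C : R := arc_sum S (fun i j => (1 - C i j)^-1).
(** [arcs] counts each edge twice, so this is [2m - (n - 1)]. As the two energies add up to [2m],
    keeping one within the budget bounds the other below by [n - 1]. *)
Definition budget S : R := arcs S - (#|S|%:R - 1).

Lemma eq_arc_sum S F1 F2 :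
  (forall i j, i \in S -> j \in S -> G i j -> F1 i j = F2 i j) ->
  arc_sum S F1 = arc_sum S F2.
Proof.
by move=> eqF; apply: eq_bigr => i iS; apply: eq_bigr => j /andP[jS ij]; apply: eqF.
Qed.

Lemma le_arc_sum S F1 F2 :
  (forall i j, i \in S -> j \in S -> G i j -> F1 i j <= F2 i j) ->
  arc_sum S F1 <= arc_sum S F2.
Proof.
by move=> leF; apply: ler_sum => i iS; apply: ler_sum => j /andP[jS ij]; apply: leF.
Qed.

Lemma arc_sumT F : arc_sum setT F = \sum_i \sum_(j | G i j) F i j.
Proof.
by apply: eq_big => [i|i _]; rewrite ?inE //; apply: eq_bigl => j; rewrite inE.
Qed.

Lemma arc_sumZ S a F : arc_sum S (fun i j => a * F i j) = a * arc_sum S F.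
Proof. by rewrite mulr_sumr; apply: eq_bigr => i _; rewrite mulr_sumr. Qed.

Lemma arc_sumD S F1 F2 :
  arc_sum S (fun i j => F1 i j + F2 i j) = arc_sum S F1 + arc_sum S F2.
Proof. by rewrite -big_split; apply: eq_bigr => i _; rewrite big_split. Qed.

Lemma arc_sum_mkcond S F :
  arc_sum S F = \sum_(i in S) \sum_(j in S) if G i j then F i j else 0.
Proof. by apply: eq_bigr => i _; rewrite big_mkcondr. Qed.

(** An edge of [S] lies in [v |: K] or in [v |: L], and not in both: the sides share only [v], which
    carries no loop. *)
Lemma arc_sum_cut S v K L F : cut G S v K L ->
  arc_sum S F = arc_sum (v |: K) F + arc_sum (v |: L) F.
Proof.
move=> cS; rewrite !arc_sum_mkcond.
rewrite -(sum2_subset _ (cut_subl cS)) -(sum2_subset _ (cut_subl (cut_sym cS))).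
rewrite -big_split; apply: eq_bigr => i iS; rewrite -big_split; apply: eq_bigr => j jS /=.
case ij: (G i j); last by rewrite !if_same addr0.
have KL k : k \in K -> k \in L = false := @cutF _ _ _ _ _ _ cS k.
have LK k : k \in L -> k \in K = false := @cutF _ _ _ _ _ _ (cut_sym cS) k.
have vKF := negPf (cut_vl cS); have vLF := negPf (cut_vr cS).
move: iS jS; rewrite (cutE cS) !inE.
have ne : (i == v) && (j == v) = false.
  by apply/negP => /andP[/eqP iv /eqP jv]; rewrite iv jv adj_irrefl in ij.
have nad := cut_nadj cS.
case: (eqVneq i v) ne => [->|_] /= ne; case: (eqVneq j v) ne => [->|_] //= ne.
- by move=> _ /orP[h|h]; rewrite h ?(KL j h) ?(LK j h) ?orbT ?addr0 ?add0r.
- by move=> /orP[h|h] _; rewrite h ?(KL i h) ?(LK i h) ?orbT ?addr0 ?add0r.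
case/orP=> iA /orP[jA|jA].
- by rewrite iA jA !(KL i) // addr0.
- by have := nad i j iA jA; rewrite ij.
- by have := nad j i jA iA; rewrite adj_sym ij.
- by rewrite iA jA !LK // add0r.
Qed.

Lemma budget_cut S v K L : cut G S v K L ->
  budget S = budget (v |: K) + budget (v |: L).
Proof.
move=> cS; rewrite /budget /arcs (arc_sum_cut _ cS).
have /(congr1 (fun n : nat => n%:R : R)) := cut_card cS.
by rewrite natrD -[in RHS]natr1 => h; lra.
Qed.

Lemma arcs_slack S :
  arcs S + \sum_(i in S) \sum_(j in S | (i != j) && ~~ G i j) 1 =
  #|S|%:R * (#|S|%:R - 1).
Proof.
rewrite -big_split mulr_natl -sumr_const; apply: eq_bigr => i iS /=.
rewrite (cardD1 i) iS natrD [1 + _]addrC addrK -sumr_const.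
rewrite [RHS](bigID (G i)) /=; congr (_ + _); apply: eq_bigl => j; rewrite !inE.
  by rewrite andbC -!andbA; case: eqVneq => [->|]; rewrite ?adj_irrefl ?andbF //= andbC.
by rewrite (eq_sym i) andbCA andbA.
Qed.

Definition complete_on S := [forall i in S, forall j in S, (i != j) ==> G i j].

Lemma arcs_le S : arcs S <= #|S|%:R * (#|S|%:R - 1).
Proof.
rewrite -arcs_slack lerDl; apply: sumr_ge0 => i _; apply: sumr_ge0 => j _; exact: ler01.
Qed.

Lemma arcs_lt S : ~~ complete_on S -> arcs S < #|S|%:R * (#|S|%:R - 1).
Proof.
case/forall_inPn => i iS /forall_inPn[j jS]; rewrite negb_imply => ij.
rewrite -arcs_slack ltrDl (bigD1 i) //= ltr_wpDr //.
  by apply: sumr_ge0 => k _; apply: sumr_ge0 => l _; exact: ler01.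
rewrite (bigD1 j) ?jS //= ltr_wpDr ?ltr01 //; apply: sumr_ge0 => l _; exact: ler01.
Qed.

Lemma arcs_complete S : complete_on S -> arcs S = #|S|%:R * (#|S|%:R - 1).
Proof.
move=> cS; rewrite -arcs_slack big1 ?addr0 // => i iS; rewrite big1 // => j.
case/and3P=> jS ij nij; have /forall_inP/(_ i iS)/forall_inP/(_ j jS) := cS.
by move=> /implyP/(_ ij); rewrite (negPf nij).
Qed.

Lemma conn_small S : conn G S -> (#|S| <= 2)%N -> complete_on S.
Proof.
move=> /connP[_ cn] S2; apply/forall_inP => i iS; apply/forall_inP => j jS.
apply/implyP => ij.
have [||x [y [/set1P-> yS]]] := cn [set i].
- by apply/properP; rewrite sub1set; split=> //; exists j; rewrite // !inE eq_sym.
- by apply/set0Pn; exists i; rewrite inE.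
rewrite inE => yi iy; suff <- : y = j by [].
apply/eqP; apply: contraTT S2 => yj; rewrite -ltnNge.
apply: leq_trans (subset_leq_card (_ : [set i; j; y] \subset S)).
  by rewrite -setUA cardsU1 !inE negb_or ij eq_sym yi cards2 eq_sym yj.
by rewrite !subUset !sub1set iS jS.
Qed.

(* The possible reasons for which [C] does not produce an extremal graph other than
   trees and complete graphs; the last one is refuted in [parts_cut]. *)
Variant status S C : Prop :=
| StatusStrict of cost S C < budget S
| StatusComplete of complete_on S &
    forall i j, i \in S -> j \in S -> i != j -> `|C i j| < 1
| StatusTree of arcs S = 2 * (#|S|%:R - 1)
| StatusCut v K L of cut G S v K L &
    (exists2 a, a \in K & G a v) & (exists2 b, b \in L & G b v) &
    (forall i j, i \in K -> j \in v |: L -> `|C i j| < 1).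

(** The invariant of the induction. [good_lt1] keeps the denominators of [cost] positive, and
    [good_status] carries the information for the equality case. *)
Record good S C : Prop := Good {
  good_corr : corr S C;
  good_lt1 : forall i j, i \in S -> j \in S -> G i j -> C i j < 1;
  good_cost : cost S C <= budget S;
  good_status : status S C }.

(** Since [C i j >= -1], each arc costs at least 1/2; comparing with the budget gives that there are
    at least [n - 1] edges. *)
Lemma good_arcs S C : good S C -> 2 * (#|S|%:R - 1) <= arcs S.
Proof.
move=> gC; have := good_cost gC; rewrite /budget.
suff : arcs S <= 2 * cost S C by lra.
rewrite -arc_sumZ; apply: le_arc_sum => i j iS jS ij.
have h := good_lt1 gC iS jS ij; have := corr_normr_le1 (good_corr gC) iS jS.
rewrite ler_norml => /andP[h' _].
by rewrite ler_pdivlMr; lra.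
Qed.

(** * Gluing good correlation matrices along a cut vertex *)

Section GlueGood.
Variables (S : {set T}) (v : T) (K L : {set T}) (C1 C2 C : T -> T -> R).
Hypotheses (cnS : conn G S) (cS : cut G S v K L) (K0 : K != set0) (L0 : L != set0).
Hypotheses (g1 : good (v |: K) C1) (g2 : good (v |: L) C2) (cC : corr S C).
Hypothesis CE1 : forall i j, i \in v |: K -> j \in v |: K -> C i j = C1 i j.
Hypothesis CE2 : forall i j, i \in v |: L -> j \in v |: L -> C i j = C2 i j.
Hypothesis C12 : forall i j, i \in K -> j \in L -> C i j = C1 i v * C2 j v.

Lemma cost_glue : cost S C = cost (v |: K) C1 + cost (v |: L) C2.
Proof.
rewrite /cost (arc_sum_cut _ cS); congr (_ + _); apply: eq_arc_sum => i j iA jA _.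
  by rewrite CE1.
by rewrite CE2.
Qed.

Lemma cost_glue_le : cost S C <= budget S.
Proof. by rewrite cost_glue (budget_cut cS) lerD ?good_cost. Qed.

Lemma norm_across i j : i \in K -> j \in v |: L -> `|C1 i v| < 1 -> `|C i j| < 1.
Proof.
move=> iK; rewrite !inE => /predU1P[-> h|jL h].
  by rewrite CE1 ?inE ?eqxx ?iK ?orbT.
rewrite C12 // normrM (le_lt_trans _ h) // ler_piMr ?normr_ge0 //.
by apply: (corr_normr_le1 (good_corr g2)); rewrite !inE ?eqxx ?jL ?orbT.
Qed.

(** A strict side makes [S] strict; a complete side makes [v] itself a suitable cut; a cut inside
    [v |: K] extends to [S]. Only when this side is a tree does the answer depend on the other one,
    hence the disjunction. *)
Lemma glue_status : status S C \/ arcs (v |: K) = 2 * (#|v |: K|%:R - 1).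
Proof.
have [lt1|_ lt1|eq1|w K' L' c' [a aK' aw] [b bL' bw] lt1] := good_status g1.
- left; apply: StatusStrict.
  by rewrite cost_glue (budget_cut cS) ltr_leD ?good_cost.
- left; apply: (StatusCut cS); [exact: cut_adj cS cnS K0|exact: cut_adj (cut_sym cS) cnS L0|].
  move=> i j iK jL; apply: norm_across => //; apply: lt1; rewrite ?inE ?eqxx ?iK ?orbT //.
  by apply: contraTneq iK => ->; exact: cut_vl cS.
- by right.
left.
have wK' := cut_vl c'; have wL' := cut_vr c'.
have subK x : x \in v |: K -> x != v -> x \in K by rewrite !inE => /predU1P[->|//]; rewrite eqxx.
have inVK x : x \in w |: (K' :|: L') -> x \in v |: K by rewrite (cutE c').
(* [L] has to join the side of the cut at [w] that contains [v]. *)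
have [vK'|vK'] := boolP (v \in K').
  have vL' : v \notin L' by rewrite (cutF c' vK').
  apply: (StatusCut (cut_sym (cut_extend cS (cut_sym c') vL'))).
  - by exists a; rewrite // inE aK'.
  - by exists b.
  move=> i j; rewrite inE => /orP[iK'|iL] jw.
    have jV : j \in w |: (K' :|: L') by move: jw; rewrite !inE => /orP[] ->; rewrite ?orbT.
    by rewrite CE1 ?lt1 ?inVK // !inE iK' orbT.
  have jK : j \in K.
    apply: subK; first by apply: inVK; move: jw; rewrite !inE => /orP[] ->; rewrite ?orbT.
    by apply: contraTneq jw => ->; rewrite !inE negb_or vL' (memPn wK').
  (* An entry between [j] and [L] has the factor [C1 j v], and the pair [v, j] already crosses the
     inner cut. *)
  have jv : `|C1 j v| < 1.
    rewrite (corr_sym (good_corr g1)) ?inE ?eqxx ?jK ?orbT //.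
    exact: lt1.
  have iv : i \in v |: L by rewrite inE iL orbT.
  rewrite (corr_sym cC) ?norm_across //.
    exact: (subsetP (cut_subl (cut_sym cS))).
  by apply: (subsetP (cut_subl cS)); rewrite inE jK orbT.
apply: (StatusCut (cut_extend cS c' vK')); first by exists a.
  by exists b; rewrite // inE bL'.
have vw : v \in w |: L'.
  have : v \in v |: K by rewrite setU11.
  by rewrite (cutE c') !inE (negPf vK').
move=> i j iK'; rewrite !inE orbA => /orP[jw|jL].
  have jV : j \in w |: (K' :|: L') by case/orP: jw; rewrite !inE => ->; rewrite ?orbT.
  by rewrite CE1 ?lt1 ?inVK // !inE ?iK' ?orbT.
apply: norm_across; last exact: lt1; last by rewrite inE jL orbT.
apply: subK; first by apply: inVK; rewrite !inE iK' orbT.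
by apply: contraNneq vK' => <-.
Qed.

End GlueGood.
End EdgeCost.

(** * Existence of cheap correlation matrices *)

Section GoodCorrelation.
Variables (R : realFieldType) (T : finType) (G : simple_graph T).
Implicit Types (S K L : {set T}) (C : T -> T -> R).

Lemma good_glue S v K L C1 C2 : conn G S -> cut G S v K L -> K != set0 -> L != set0 ->
  good G (v |: K) C1 -> good G (v |: L) C2 -> exists C, good G S C.
Proof.
move=> cnS cS K0 L0 g1 g2.
have [c1 c2] := (good_corr g1, good_corr g2).
pose C := glue v K L C1 C2; exists C.
have cC : corr S C := corr_glue cS c1 c2.
have E1 i j : i \in v |: K -> j \in v |: K -> C i j = C1 i j by exact: glue_left cS c1 c2 i j.
have E2 i j : i \in v |: L -> j \in v |: L -> C i j = C2 i j by exact: glue_right cS c1 c2 i j.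
have E12 i j : i \in K -> j \in L -> C i j = C1 i v * C2 j v by exact: glue_across cS i j.
have E21 i j : i \in L -> j \in K -> C i j = C2 i v * C1 j v.
  move=> iL jK; rewrite mulrC -E12 // (corr_sym cC) //.
    by apply: (subsetP (cut_subl (cut_sym cS))); rewrite inE iL orbT.
  by apply: (subsetP (cut_subl cS)); rewrite inE jK orbT.
split=> //.
- move=> i j; rewrite (cutE cS) !inE => iS jS ij.
  have [iK|iK] := boolP ((i == v) || (i \in K)); have [jK|jK] := boolP ((j == v) || (j \in K)).
  + by rewrite E1 ?inE // (good_lt1 g1) ?inE.
  + have jL : j \in L by move: jS; rewrite orbA (negPf jK).
    have [iK'|iK'] := boolP (i \in K); first by have := cut_nadj cS iK' jL; rewrite ij.
    move: iK; rewrite (negPf iK') orbF => /eqP iv.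
    by rewrite E2 ?(good_lt1 g2) // !inE ?iv ?eqxx ?jL ?orbT.
  + have iL : i \in L by move: iS; rewrite orbA (negPf iK).
    have [jK'|jK'] := boolP (j \in K).
      by have := cut_nadj cS jK' iL; rewrite adj_sym ij.
    move: jK; rewrite (negPf jK') orbF => /eqP jv.
    by rewrite E2 ?(good_lt1 g2) // !inE ?jv ?eqxx ?iL ?orbT.
  + have iL : i \in L by move: iS; rewrite orbA (negPf iK).
    have jL : j \in L by move: jS; rewrite orbA (negPf jK).
    by rewrite E2 ?(good_lt1 g2) // !inE ?jL ?iL ?orbT.
- exact: cost_glue_le cS g1 g2 E1 E2.
(* If neither side settles the status, both have the arc count of a tree, and so has [S]. *)
have [//|t1] := glue_status cnS cS K0 L0 g1 g2 cC E1 E2 E12.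
have [//|t2] := glue_status cnS (cut_sym cS) L0 K0 g2 g1 cC E2 E1 E21.
apply: StatusTree; have := budget_cut R cS; rewrite /budget t1 t2.
have /(congr1 (fun n : nat => n%:R : R)) := cut_card cS.
by rewrite natrD -[in RHS]natr1; lra.
Qed.

(* Weighted Cauchy-Schwarz, with weight [a] on the unit term. *)
Lemma inv_sum_le (I : finType) (P : pred I) (r : I -> R) (a b : R) :
  (forall i, P i -> 0 < r i) -> a + b * \sum_(i | P i) 1 = 1 ->
  (1 + \sum_(i | P i) r i)^-1 <= a ^+ 2 + b ^+ 2 * \sum_(i | P i) (r i)^-1.
Proof.
move=> r0 ab; set t := 1 + _.
have t0 : 0 < t by rewrite ltr_pwDl // sumr_ge0 // => i /r0/ltW.
(* The tangent to [b^2 / x] at [x = b t]. *)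
have term x : 0 < x -> 2 * b / t - x / t ^+ 2 <= b ^+ 2 * x^-1.
  move=> x0; rewrite -subr_ge0.
  have -> : b ^+ 2 * x^-1 - (2 * b / t - x / t ^+ 2) = (b * t - x) ^+ 2 / (x * t ^+ 2).
    by field; rewrite !gt_eqF.
  by rewrite divr_ge0 ?sqr_ge0 // mulr_ge0 ?sqr_ge0 // ltW.
have : \sum_(i | P i) (2 * b / t - r i / t ^+ 2) <= \sum_(i | P i) b ^+ 2 * (r i)^-1.
  by apply: ler_sum => i /r0/term.
rewrite -mulr_sumr => h; apply: le_trans (lerD (lexx _) h).
have sumc (c : R) : \sum_(i | P i) c = c * \sum_(i | P i) 1.
  by rewrite mulr_sumr; apply: eq_bigr => i _; rewrite mulr1.
rewrite sumrB [\sum_(i | P i) (2 * b / t)]sumc -mulr_suml.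
clear h term; set s := \sum_(i | P i) 1 in ab *; set q := \sum_(i | P i) r i in t t0 *.
have bs : b * s = 1 - a by rewrite -ab addrC addKr.
have qE : q = t - 1 by rewrite /t addrC addKr.
rewrite -subr_ge0 mulrAC -(mulrA 2) bs qE.
have -> : a ^+ 2 + (2 * (1 - a) / t - (t - 1) / t ^+ 2) - t^-1 = (a - t^-1) ^+ 2.
  by field; rewrite gt_eqF.
exact: sqr_ge0.
Qed.

(** * Averaging over vertex-deleted subgraphs *)

Section Average.
Variables (S : {set T}) (D : T -> T -> T -> R).
Hypothesis S3 : (2 < #|S|)%N.
Hypothesis gD : forall w, w \in S -> good G (S :\ w) (D w).

Let n : R := #|S|%:R.
Let n3 : 3 <= n. Proof. by rewrite ler_nat. Qed.

(* The Gram matrix of the vectors obtained by concatenating the configurations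
   [D w], where vertex [w] is given the zero vector in the [w]-th block. *)
Definition average (i j : T) : R :=
  (n - 1)^-1 * \sum_(w in S | (w != i) && (w != j)) D w i j.

Lemma card_setD1 w : w \in S -> #|S :\ w|%:R = n - 1 :> R.
Proof. by move=> wS; rewrite /n (cardsD1 w S) wS natrD addrC addKr. Qed.

Lemma sum_others i : i \in S -> \sum_(w in S | w != i) 1 = n - 1.
Proof.
move=> iS; rewrite -(card_setD1 iS) -sumr_const; apply: eq_bigl => w.
by rewrite !inE andbC.
Qed.

Lemma sum_others2 i j : i \in S -> j \in S -> i != j ->
  \sum_(w in S | (w != i) && (w != j)) 1 = n - 2.
Proof.
move=> iS jS ij; have := sum_others iS.
rewrite (bigD1 j) /=; last by rewrite jS eq_sym.
under eq_bigl => w do rewrite -andbA.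
by move=> h; lra.
Qed.

Lemma corr_average : corr S average.
Proof.
have n1 : 0 < n - 1 by have := n3; lra.
split=> [x|i j iS jS|i iS].
- rewrite (eq_bigr (fun i => (n - 1)^-1 * \sum_(j in S)
    \sum_(w in S | (w != i) && (w != j)) x i * x j * D w i j)); last first.
    move=> i _; rewrite mulr_sumr; apply: eq_bigr => j _.
    by rewrite /average -mulr_sumr; ring.
  rewrite -mulr_sumr mulr_ge0 ?invr_ge0 ?(ltW n1) //.
  have := sum_avoiding S (fun _ _ => true) (fun w i j => x i * x j * D w i j).
  under eq_bigr => i _ do under eq_bigl => j do rewrite andbT.
  move=> ->; apply: sumr_ge0 => w wS.
  under eq_bigr => i _ do under eq_bigl => j do rewrite andbT.
  exact: (corr_psd (good_corr (gD wS))).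
- rewrite /average; congr (_ * _); rewrite (eq_bigl (fun w => (w \in S) && ((w != j) && (w != i)))).
    apply: eq_bigr => w /and3P[wS wj wi].
    by rewrite (corr_sym (good_corr (gD wS))) // !inE eq_sym ?wi ?wj.
  by move=> w; rewrite andbA andbAC -andbA.
rewrite /average (eq_bigr (fun=> 1)) => [|w /andP[wS /andP[wi _]]].
  under eq_bigl => w do rewrite andbb.
  by rewrite sum_others // mulVf // gt_eqF.
by rewrite (corr_diag (good_corr (gD wS))) // !inE eq_sym wi.
Qed.

(** Distinct [i] and [j] are both present in only [n - 2] blocks, while the normalisation is
    [n - 1]. The missing block is the unit term, which keeps [average i j] below 1 even if every
    [D w i j] is 1. *)
Lemma average_sub1 i j : i \in S -> j \in S -> i != j ->
  1 - average i j =
  (n - 1)^-1 * (1 + \sum_(w in S | (w != i) && (w != j)) (1 - D w i j)).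
Proof.
move=> iS jS ij; rewrite sumrB sum_others2 // /average.
have n1 : n - 1 != 0 by have := n3; lra.
by field.
Qed.

Lemma average_lt1 i j : i \in S -> j \in S -> G i j -> average i j < 1.
Proof.
move=> iS jS ij.
have neq : i != j by apply: contraTneq ij => ->; rewrite adj_irrefl.
have n1 : 0 < n - 1 by have := n3; lra.
rewrite -subr_gt0 average_sub1 // mulr_gt0 ?invr_gt0 // ltr_pwDl //.
apply: sumr_ge0 => w /and3P[wS wi wj]; rewrite subr_ge0.
by apply: (corr_le1 (good_corr (gD wS))); rewrite !inE eq_sym ?wi ?wj.
Qed.

Lemma average_norm_lt1 i j : i \in S -> j \in S -> i != j -> `|average i j| < 1.
Proof.
move=> iS jS ij.
have n1 : 0 < n - 1 by have := n3; lra.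
rewrite /average normrM gtr0_norm ?invr_gt0 // mulrC ltr_pdivrMr // mul1r.
apply: le_lt_trans (ler_norm_sum _ _ _) _.
apply: (@le_lt_trans _ _ (\sum_(w in S | (w != i) && (w != j)) 1)).
  apply: ler_sum => w /and3P[wS wi wj].
  by apply: (corr_normr_le1 (good_corr (gD wS))); rewrite !inE eq_sym ?wi ?wj.
by rewrite sum_others2 //; lra.
Qed.

Lemma sum_arcs_others : \sum_(w in S) arcs R G (S :\ w) = (n - 2) * arcs R G S.
Proof.
rewrite -(sum_avoiding S G (fun _ _ _ => 1)) /arcs -arc_sumZ.
apply: eq_bigr => i iS; apply: eq_bigr => j /andP[jS ij].
rewrite sum_others2 ?mulr1 //; by apply: contraTneq ij => ->; rewrite adj_irrefl.
Qed.

Lemma sum_cost_others : \sum_(w in S) cost G (S :\ w) (D w) =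
  arc_sum G S (fun i j => \sum_(w in S | (w != i) && (w != j)) (1 - D w i j)^-1).
Proof. by rewrite -(sum_avoiding S G (fun w i j => (1 - D w i j)^-1)). Qed.

Lemma sum_cost_others_le :
  \sum_(w in S) cost G (S :\ w) (D w) <= (n - 2) * (arcs R G S - n).
Proof.
have : \sum_(w in S) cost G (S :\ w) (D w) <= \sum_(w in S) (arcs R G (S :\ w) - (n - 2)).
  apply: ler_sum => w wS; have := good_cost (gD wS); rewrite /budget card_setD1 //; lra.
rewrite sumrB sum_arcs_others sumr_const -(mulr_natl _ #|S|) -/n; lra.
Qed.

(** [good_arcs] summed over all vertex deletions; each arc survives [n - 2] of them. The bound makes
    the denominator in [cost_average] positive. *)
Lemma arcs_ge_twice : 2 * n <= arcs R G S.
Proof.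
have : \sum_(w in S) 2 * (n - 2) <= \sum_(w in S) arcs R G (S :\ w).
  apply: ler_sum => w wS; have := good_arcs (gD wS); rewrite card_setD1 //; lra.
rewrite sum_arcs_others sumr_const -(mulr_natl _ #|S|) -/n => h.
have n2 : 0 < n - 2 by have := n3; lra.
rewrite -(ler_pM2l n2); lra.
Qed.

(* The weights [a] and [b] minimise the bound given by [inv_sum_le]. *)
Lemma cost_average :
  cost G S average <= budget R G S
    - (n * (n - 1) - arcs R G S) / ((n - 1) * arcs R G S - n).
Proof.
set x := arcs R G S; have x2 : 2 * n <= x := arcs_ge_twice; have n3' := n3.
have d0 : 0 < (n - 1) * x - n by nra.
set d := _ - n in d0 *.
pose a := (x - n) / d; pose b := x / d.
have ab : a + b * (n - 2) = 1 by rewrite /a /b /d; field; rewrite gt_eqF.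
have le1 : cost G S average <= (n - 1) * (a ^+ 2 * x + b ^+ 2 * ((n - 2) * (x - n))).
  apply: (@le_trans _ _ (arc_sum G S (fun i j => (n - 1) * (a ^+ 2 * 1 +
      b ^+ 2 * \sum_(w in S | (w != i) && (w != j)) (1 - D w i j)^-1)))).
    apply: le_arc_sum => i j iS jS ij.
    have neq : i != j by apply: contraTneq ij => ->; rewrite adj_irrefl.
    rewrite average_sub1 // invfM invrK ler_pM2l; last by lra.
    rewrite mulr1 inv_sum_le ?sum_others2 // => w /and3P[wS wi wj].
    by rewrite subr_gt0 (good_lt1 (gD wS)) // !inE eq_sym ?wi ?wj.
  rewrite arc_sumZ ler_pM2l; last by lra.
  rewrite arc_sumD !arc_sumZ -sum_cost_others lerD2l ler_wpM2l ?sqr_ge0 //.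
  exact: sum_cost_others_le.
apply: le_trans le1 _; rewrite /budget -/x -/n le_eqVlt; apply/orP; left; apply/eqP.
by rewrite /a /b /d; field; rewrite gt_eqF.
Qed.

(** The term subtracted in [cost_average] is nonnegative, and positive unless [S] is complete. *)
Lemma good_average : good G S average.
Proof.
have x2 := arcs_ge_twice; have n3' := n3.
have d0 : 0 < (n - 1) * arcs R G S - n by nra.
have c0 := cost_average.
split; [exact: corr_average|exact: average_lt1| |].
  apply: le_trans c0 _; rewrite gerBl divr_ge0 ?(ltW d0) // subr_ge0; exact: arcs_le.
have [cS|/arcs_lt h] := boolP (complete_on G S).
  by apply: StatusComplete cS _; exact: average_norm_lt1.
by apply: StatusStrict; apply: le_lt_trans c0 _; rewrite gtrBl divr_gt0 // subr_gt0 h.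
Qed.

End Average.

Lemma good_small S : conn G S -> (#|S| <= 2)%N -> exists C, good G S C.
Proof.
move=> cnS S2; have /connP[/set0Pn[a aS] _] := cnS.
(* A rank-one sign matrix: the ends of an edge have correlation -1, so each arc costs exactly 1/2
   and the budget of a tree is met with equality. *)
pose e (k : T) : R := if k == a then 1 else -1.
exists (fun i j => e i * e j).
have e2 i : e i * e i = 1 by rewrite /e; case: ifP => _; rewrite ?mulrNN mulr1.
have eE i j : i \in S -> j \in S -> G i j -> e i * e j = -1.
  move=> iS jS ij; have neq : i != j by apply: contraTneq ij => ->; rewrite adj_irrefl.
  suff: (i == a) != (j == a) by rewrite /e; case: (i == a); case: (j == a); rewrite ?mul1r ?mulr1.
  apply/negP => /eqP eqa.
  have ja : j != a by apply: contraNneq neq => ja; rewrite ja eqxx in eqa; rewrite (eqP eqa) ja.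
  have ia : i != a by rewrite eqa.
  have : (#|[set a; i; j]| <= 2)%N.
    by apply: leq_trans S2; apply: subset_leq_card; rewrite !subUset !sub1set aS iS jS.
  by rewrite -setUA cardsU1 !inE negb_or eq_sym ia eq_sym ja cards2 neq.
have cE : cost G S (fun i j => e i * e j) = arcs R G S / 2.
  rewrite mulrC -arc_sumZ; apply: eq_arc_sum => i j iS jS ij.
  by rewrite eE //; field.
have tree : arcs R G S = 2 * (#|S|%:R - 1).
  rewrite (arcs_complete _ (conn_small cnS S2)).
  have : (0 < #|S|)%N by rewrite (cardD1 a) aS.
  by move: S2; case: #|S| => [|[|[|]]] // _ _; ring.
split.
- split=> [x|i j _ _|i _]; last exact: e2; last exact: mulrC.
  under eq_bigr => i _ do under eq_bigr => j _ do rewrite mulrACA.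
  under eq_bigr => i _ do rewrite -mulr_sumr.
  by rewrite -mulr_suml -expr2 sqr_ge0.
- by move=> i j iS jS ij; rewrite eE //; lra.
- by rewrite cE /budget tree; lra.
- exact: StatusTree.
Qed.

Theorem exists_good S : conn G S -> exists C, good G S C.
Proof.
have [m] := ubnP #|S|; elim: m S => // m IH S; rewrite ltnS => Sm cnS.
have [S2|S3] := leqP #|S| 2; first exact: good_small.
(* A vertex whose deletion disconnects [S] leads to gluing; if there is none, the induction
   hypothesis applies to every [S :\ w] and the results are averaged. *)
have [/existsP[v /andP[vS ncn]]|/existsPn allc] :=
  boolP [exists v, (v \in S) && ~~ conn G (S :\ v)].
  have S0 : S :\ v != set0.
    by rewrite -card_gt0; move: S3; rewrite (cardsD1 v) vS; case: #|_|.
  have [K [L [cS K0 L0]]] := disconnected_cut vS S0 ncn.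
  have [C1 g1] : exists C, good G (v |: K) C.
    by apply: IH; [apply: leq_trans Sm; exact: cut_ltl cS L0|exact: cut_conn cS cnS].
  have [C2 g2] : exists C, good G (v |: L) C.
    apply: IH; last exact: cut_conn (cut_sym cS) cnS.
    by apply: leq_trans Sm; exact: cut_ltl (cut_sym cS) K0.
  exact: good_glue cnS cS K0 L0 g1 g2.
have /fin_all_exists[D DP] w : exists C, w \in S -> good G (S :\ w) C.
  have [wS|] := boolP (w \in S); last by exists (fun _ _ => 0).
  have := allc w; rewrite wS negbK => cw.
  have [|C gC] := IH (S :\ w) _ cw; last by exists C.
  by apply: leq_trans Sm; rewrite [X in (_ < X)%N](cardsD1 w) wS.
by exists (average S D); apply: good_average.
Qed.

End GoodCorrelation.

(** * Square energies *)

Section SquareEnergy.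
Variables (R : realFieldType) (T : finType) (G : simple_graph T).

(* [M] and [N] are the positive and negative parts of the adjacency matrix when
   [e = 1], and the other way round when [e = -1]. *)
Record parts (e : R) (M N : T -> T -> R) : Prop := Parts {
  parts_root : exists2 W : T -> T -> R, (forall i j, W i j = W j i) &
    forall i j, M i j = \sum_k W i k * W k j;
  parts_root' : exists2 Z : T -> T -> R, (forall i j, Z i j = Z j i) &
    forall i j, N i j = \sum_k Z i k * Z k j;
  parts_adj : forall i j, M i j - N i j = e * (G i j)%:R;
  parts_orth : forall i j, \sum_k M i k * N k j = 0 }.

Variables (e : R) (M N : T -> T -> R).
Hypotheses (ee : e * e = 1) (pMN : parts e M N).

Definition energy : R := \sum_i \sum_j M i j ^+ 2.

Lemma parts_sym i j : M i j = M j i.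
Proof.
have [W symW ME] := parts_root pMN; rewrite !ME; apply: eq_bigr => k _.
by rewrite mulrC symW (symW i).
Qed.

(** [M^2 = e M A]: substitute [N = M - e A] in [M N = 0]. *)
Lemma parts_square i j : \sum_k M i k * M k j = e * \sum_(k | G k j) M i k.
Proof.
have NE k : N k j = M k j - e * (G k j)%:R.
  by rewrite -(parts_adj pMN) opprB addrC subrK.
have := parts_orth pMN i j.
under eq_bigr => k _ do rewrite NE mulrBr.
rewrite sumrB => /subr0_eq ->; rewrite mulr_sumr [RHS]big_mkcond; apply: eq_bigr => k _.
by case: (G k j); rewrite ?mulr1 ?mulr0 // mulrC.
Qed.

Lemma energy_arcs : energy = arc_sum G setT (fun i j => e * M i j).
Proof.
rewrite arc_sumT; apply: eq_bigr => i _.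
rewrite -mulr_sumr; have := parts_square i i.
under [X in _ = e * X -> _]eq_bigl => k do rewrite adj_sym.
by move=> <-; apply: eq_bigr => j _; rewrite expr2 [X in _ * X]parts_sym.
Qed.

(** The diagonal entry of [M^2 = e M A], with the adjacent terms moved to the right. The left-hand
    sum includes [j = i]. *)
Lemma nonadjacent_mass i :
  \sum_(j | ~~ G i j) M i j ^+ 2 = \sum_(j | G i j) (e * M i j - M i j ^+ 2).
Proof.
have := parts_square i i; rewrite mulr_sumr.
under [X in _ = X -> _]eq_bigl => k do rewrite adj_sym.
under [X in X = _ -> _]eq_bigr => k _ do rewrite [X in _ * X]parts_sym -expr2.
by rewrite (bigID (G i)) /= sumrB => <-; rewrite addrAC subrr add0r.
Qed.

(** Completing the square on each arc, with [nonadjacent_mass] accounting for the remaining entries.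
    For a good [C] the three sums are nonnegative, by squares, by the Schur product theorem and by
    [C i j <= 1], so all vanish at equality. *)
Lemma cost_sub_energy C :
  (forall i j, G i j -> C i j < 1) ->
  cost G setT C - energy =
  arc_sum G setT (fun i j => (1 - e * (1 - C i j) * M i j) ^+ 2 / (1 - C i j))
  + \sum_i \sum_j M i j ^+ 2 * C i j
  + \sum_i \sum_(j | ~~ G i j) M i j ^+ 2 * (1 - C i j).
Proof.
move=> C1; rewrite energy_arcs /cost !arc_sumT.
rewrite -sumrB -!big_split /=; apply: eq_bigr => i _.
rewrite [X in _ + X + _](bigID (G i)) /= -addrA -addrA -big_split /=.
under [X in _ = _ + (_ + X)]eq_bigr => j _ do rewrite -mulrDr addrC subrK mulr1.
rewrite nonadjacent_mass -!big_split -sumrB; apply: eq_bigr => j ij /=.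
have r0 : 1 - C i j != 0 by rewrite subr_eq0 gt_eqF // C1.
have -> : (1 - e * (1 - C i j) * M i j) ^+ 2 =
    1 - 2 * e * (1 - C i j) * M i j + (1 - C i j) ^+ 2 * M i j ^+ 2.
  by rewrite sqrrB !exprMn [e ^+ 2]expr2 ee; ring.
by field.
Qed.

(* The [(i, j)] entry of [M ^ 2 = e M A]; only the index [v] survives in both sums. *)
Lemma parts_across v K L i j : cut G setT v K L ->
  (forall i j, i \in K -> j \in L -> M i j = 0) -> i \in K -> j \in L ->
  M i v * M v j = e * (G v j)%:R * M i v.
Proof.
move=> cT M0 iK jL; have := parts_square i j.
have allT k : k != v -> k \in K \/ k \in L.
  move=> kv; have : k \in [set: T] by rewrite inE.
  by rewrite (cutE cT) !inE (negPf kv) /= => /orP.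
rewrite (bigD1 v) //= big1 ?addr0 => [|k /allT[kK|kL]]; last 2 first.
- by rewrite (M0 k j) ?mulr0.
- by rewrite (M0 i k) ?mul0r.
move=> ->; rewrite big_mkcond (bigD1 v) //= big1 ?addr0 => [|k /allT[kK|kL]]; last 2 first.
- by rewrite (negPf (cut_nadj cT kK jL)).
- by rewrite (M0 i k) // if_same.
by case: (G v j); rewrite ?mulr1 ?mulr0 ?mul0r.
Qed.

(** [parts_across] forces row [v] of [M] to agree with that of [e A] off the diagonal. The [(v, v)]
    entry of [M^2 = e M A] then gives [M v v = 0], so row [v] of the square root [W] vanishes, and
    with it [M a v]. *)
Lemma parts_cut v K L a b : cut G setT v K L -> a \in K -> b \in L -> G a v -> G b v ->
  M a v != 0 -> M b v != 0 -> (forall i j, i \in K -> j \in L -> M i j = 0) -> False.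
Proof.
move=> cT aK bL av bv Mav Mbv M0.
have allT k : [\/ k = v, k \in K | k \in L].
  have : k \in [set: T] by rewrite inE.
  by rewrite (cutE cT) !inE => /or3P[/eqP|h|h]; [apply: Or31|apply: Or32|apply: Or33].
have e0 : e != 0 by apply/eqP => e0; move/esym/eqP: ee; rewrite e0 mul0r oner_eq0.
have prod i j := @parts_across v K L i j cT M0.
have prod' i j : i \in K -> j \in L -> M i v * M v j = e * (G i v)%:R * M v j.
  move=> iK jL; have := @parts_across v L K j i (cut_sym cT) _ jL iK.
  rewrite mulrC (parts_sym v i) (parts_sym j v) adj_sym; apply.
  by move=> k l kL lK; rewrite parts_sym M0.
have Mvb : M v b = e.
  by have := prod a b aK bL; rewrite adj_sym bv mulr1 mulrC => /(mulIf Mav).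
have Mva : M a v = e.
  have := prod' a b aK bL; rewrite av mulr1 => /mulIf; apply.
  by rewrite parts_sym.
have Mv k : k != v -> M v k = e * (G v k)%:R.
  case: (allT k) => [->|kK _|kL _]; first by rewrite eqxx.
    by have := prod' k b kK bL; rewrite Mvb => /(mulIf e0); rewrite parts_sym adj_sym.
  by have := prod a k aK kL; rewrite Mva mulrC => /(mulIf e0).
have Mvv : M v v = 0.
  have := parts_square v v.
  rewrite (bigD1 v) //= mulr_sumr [X in _ = X -> _]big_mkcond /= [X in _ = X -> _](bigD1 v) //=.
  rewrite adj_irrefl add0r.
  rewrite (eq_bigr (fun k => if G k v then e * M v k else 0)) => [|k kv].
    by rewrite -[X in _ = X -> _]add0r => /addIr/eqP; rewrite mulf_eq0 orbb => /eqP.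
  rewrite [M k v]parts_sym Mv // (adj_sym G k v).
  by case: (G v k); rewrite ?mulr1 ?mulr0 ?mul0r.
have [W symW ME] := parts_root pMN.
have Wv k : W v k = 0.
  have : \sum_k W v k ^+ 2 = 0.
    by rewrite -[RHS]Mvv ME; apply: eq_bigr => l _; rewrite expr2 [X in _ * X]symW.
  move/eqP; rewrite psumr_eq0 => [/allP/(_ k (mem_index_enum _))|l _]; last exact: sqr_ge0.
  by rewrite sqrf_eq0 => /eqP.
by move: Mav; rewrite ME big1 ?eqxx // => k _; rewrite [W k v]symW Wv mulr0.
Qed.

Section GoodBound.
Variable C : T -> T -> R.
Hypothesis gC : good G setT C.

Let C1 i j : G i j -> C i j < 1. Proof. by apply: (good_lt1 gC); rewrite inE. Qed.

Let mass_ge0 i j : 0 <= M i j ^+ 2 * (1 - C i j).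
Proof. by rewrite mulr_ge0 ?sqr_ge0 // subr_ge0 (corr_le1 (good_corr gC)). Qed.

Let gap_ge0 i j : G i j -> 0 <= (1 - e * (1 - C i j) * M i j) ^+ 2 / (1 - C i j).
Proof. by move=> ij; rewrite divr_ge0 ?sqr_ge0 // subr_ge0 ltW ?C1. Qed.

Let psd_ge0 : 0 <= \sum_i \sum_j M i j ^+ 2 * C i j.
Proof.
have [W symW ME] := parts_root pMN.
rewrite (_ : \sum_i _ = \sum_(i in setT) \sum_(j in setT) (\sum_k W i k * W k j) ^+ 2 * C i j).
  exact: psd_entrywise_square (corr_psd (good_corr gC)) symW.
apply: eq_big => [i|i _]; first by rewrite inE.
by apply: eq_big => [j|j _]; rewrite ?inE ?ME.
Qed.

Lemma energy_le_cost : energy <= cost G setT C.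
Proof.
rewrite -subr_ge0 cost_sub_energy // arc_sumT !addr_ge0 //.
  by apply: sumr_ge0 => i _; apply: sumr_ge0 => j; exact: gap_ge0.
by apply: sumr_ge0 => i _; apply: sumr_ge0 => j _; exact: mass_ge0.
Qed.

Hypothesis eqC : energy = cost G setT C.

(** At equality, the vanishing squares say [e * (1 - C i j) * M i j = 1] on edges, and the vanishing
    third sum handles the non-edges. *)
Lemma extremal_terms :
  (forall i j, G i j -> M i j != 0) /\ (forall i j, ~~ G i j -> C i j < 1 -> M i j = 0).
Proof.
have := cost_sub_energy C1; rewrite eqC subrr arc_sumT.
set s1 := \sum_i _; set s2 := \sum_i _; set s3 := \sum_i _ => eq0.
have s1_ge0 : 0 <= s1 by apply: sumr_ge0 => i _; apply: sumr_ge0 => j; exact: gap_ge0.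
have s3_ge0 : 0 <= s3 by apply: sumr_ge0 => i _; apply: sumr_ge0 => j _; exact: mass_ge0.
have s2_ge0 : 0 <= s2 := psd_ge0.
have s1_0 : s1 = 0 by lra.
have s3_0 : s3 = 0 by lra.
split=> i j ij.
  have h1 : \sum_(l | G i l) (1 - e * (1 - C i l) * M i l) ^+ 2 / (1 - C i l) = 0.
    apply: (psumr_eq0P _ s1_0) => // k _.
    by apply: sumr_ge0 => l; exact: gap_ge0.
  have h2 := psumr_eq0P (fun l (il : G i l) => gap_ge0 il) h1 ij.
  move/eqP: h2; rewrite mulf_eq0 invr_eq0 subr_eq0 [1 == C i j]eq_sym (lt_eqF (C1 ij)) orbF.
  by rewrite sqrf_eq0; apply: contraTneq => ->; rewrite mulr0 subr0 oner_eq0.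
move=> Cij.
have h1 : \sum_(l | ~~ G i l) M i l ^+ 2 * (1 - C i l) = 0.
  apply: (psumr_eq0P _ s3_0) => // k _.
  by apply: sumr_ge0 => l _; exact: mass_ge0.
have h2 := psumr_eq0P (fun l _ => mass_ge0 i l) h1 ij.
move/eqP: h2; rewrite mulf_eq0 subr_eq0 [1 == C i j]eq_sym (lt_eqF Cij) orbF sqrf_eq0.
by move/eqP.
Qed.

End GoodBound.

Hypothesis cnT : conn G setT.

Lemma energy_le : energy <= budget R G setT.
Proof.
have [C gC] := exists_good R cnT.
exact: le_trans (energy_le_cost gC) (good_cost gC).
Qed.

Lemma energy_extremal : energy = budget R G setT ->
  complete_on G setT \/ arcs R G setT = 2 * (#|T|%:R - 1).
Proof.
move=> eqB; have [C gC] := exists_good R cnT.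
have eqC : energy = cost G setT C.
  by apply/eqP; rewrite eq_le (energy_le_cost gC) eqB (good_cost gC).
have [Madj Mnadj] := extremal_terms gC eqC.
have [lt|cT _|tr|v K L cT [a aK av] [b bL bv] lt1] := good_status gC.
- by move: lt; rewrite -eqC eqB ltxx.
- by left.
- by right; rewrite tr cardsT.
exfalso; apply: (parts_cut cT aK bL av bv); [exact: Madj|exact: Madj|].
move=> i j iK jL; apply: Mnadj; first exact: (cut_nadj cT iK jL).
by apply: le_lt_trans (ler_norm _) (lt1 _ _ iK _); rewrite inE jL orbT.
Qed.

End SquareEnergy.

(** * Trees *)

Section Trees.
Variables (T : finType) (G : simple_graph T).
Implicit Types (S K L : {set T}).

Lemma connected_conn : connected_graph G -> conn G setT.
Proof.
case=> T0 cn; apply/connP; split; first by rewrite -card_gt0 cardsT.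
move=> K /properP[_ [y _ yK]] /set0Pn[x xK].
have [/exists_inP[u uK /exists_inP[w wK uw]]|nK] :=
  boolP [exists u in K, exists w in ~: K, G u w].
  by exists u, w; split=> //; rewrite inE in wK.
have out u w : u \in K -> G u w -> w \in K.
  move=> uK uw; apply: contraR nK => wK; apply/exists_inP; exists u => //.
  by apply/exists_inP; exists w; rewrite ?inE.
have clK : closed G K.
  by move=> u w uw; apply/idP/idP => /out; apply=> //; rewrite adj_sym.
by have := closed_connect clK (cn x y); rewrite xK (negPf yK).
Qed.

Definition adj_in S : rel T := [rel x y | [&& x \in S, y \in S & G x y]].

Lemma adj_in_sym S : symmetric (adj_in S).
Proof. by move=> x y; rewrite /adj_in /= adj_sym andbCA. Qed.

Lemma conn_connect S a b : conn G S -> a \in S -> b \in S -> connect (adj_in S) a b.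
Proof.
move=> /connP[_ cn] aS bS; apply: contraT => nab.
pose K := [set y in S | connect (adj_in S) a y].
have [||x [y [xK yS yK xy]]] := cn K.
- apply/properP; split; first by apply/subsetP => y; rewrite inE => /andP[].
  by exists b; rewrite // inE bS.
- by apply/set0Pn; exists a; rewrite inE aS connect0.
move: xK yK; rewrite !inE yS /= => /andP[xS ax] /negP[].
by apply: connect_trans ax (connect1 _); rewrite /adj_in /= xS yS.
Qed.

(** A repetition-free path from [a] to [b] inside [S] closes up through [v]; [a != b] ensures three
    vertices. *)
Lemma connect_in_cycle S v a b : v \notin S -> a != b -> G v a -> G b v ->
  a \in S -> connect (adj_in S) a b -> exists2 c, ucycle G c & (2 < size c)%N.
Proof.
move=> vS ab va bv aS /connectP[q pq lq].
case: (shortenP pq) lq => p pp up _ lp {q pq}.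
have pS : all (mem S) p.
  elim: p a pp {ab va aS up lp} => //= y p IH x /andP[/and3P[_ yS _] /IH->].
  by rewrite yS.
have pG : path G a p by apply: sub_path pp => x y /and3P[].
exists (v :: a :: p); last by case: p lp ab {pp up pS pG} => //= ->; rewrite eqxx.
rewrite /ucycle /= va rcons_path pG -lp bv /=; move: up => /= ->; rewrite andbT.
rewrite inE negb_or; apply/andP; split; first by apply: contraNneq vS => ->.
by apply: contra vS => /(allP pS).
Qed.

Section Arcs.
Variable R : realFieldType.
Local Notation arcs := (arcs R G).

Lemma arcs_setU1 v S : v \notin S ->
  arcs (v |: S) = arcs S + 2 * #|[set u in S | G v u]|%:R.
Proof.
move=> vS; rewrite /arcs !arc_sum_mkcond big_setU1 //= big_setU1 //= adj_irrefl add0r.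
have degE : \sum_(j in S) (if G v j then 1 else 0) = #|[set u in S | G v u]|%:R :> R.
  rewrite -big_mkcondr -sumr_const; apply: eq_bigl => u; by rewrite inE.
rewrite degE; under [X in _ + X]eq_bigr => i _ do rewrite big_setU1 // adj_sym.
by rewrite big_split /= degE; ring.
Qed.

Lemma conn_arcs_ge S : conn G S -> 2 * (#|S|%:R - 1) <= arcs S.
Proof. by move=> /(exists_good R)[C]; exact: good_arcs. Qed.

(** Induction on a vertex [v]: if it cuts [S], arc counts add over the sides; otherwise it has at
    most one neighbour in [S], since two would be joined in [S :\ v] and close a cycle. *)
Lemma acyclic_arcs_le S : acyclic_graph G -> conn G S -> arcs S <= 2 * (#|S|%:R - 1).
Proof.
move=> acG; have [m] := ubnP #|S|; elim: m S => // m IH S; rewrite ltnS => Sm cnS.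
have /connP[/set0Pn[v vS] _] := cnS.
have [S0|S0] := eqVneq (S :\ v) set0.
  have S1 : #|S| = 1%N by rewrite (cardsD1 v) vS S0 cards0.
  by have := arcs_le R G S; rewrite S1 subrr !mulr0.
have cardS : #|S|%:R = #|S :\ v|%:R + 1 :> R by rewrite (cardsD1 v S) vS natrD addrC.
have [cn|ncn] := boolP (conn G (S :\ v)); last first.
  have [K [L [cS K0 L0]]] := disconnected_cut vS S0 ncn.
  have := budget_cut R cS; rewrite /budget.
  have := IH _ (leq_trans (cut_ltl cS L0) Sm) (cut_conn cS cnS).
  have := IH _ (leq_trans (cut_ltl (cut_sym cS) K0) Sm) (cut_conn (cut_sym cS) cnS).
  have /(congr1 (fun n : nat => n%:R : R)) := cut_card cS.
  rewrite natrD -[in RHS]natr1; lra.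
have IHv : arcs (S :\ v) <= 2 * (#|S :\ v|%:R - 1).
  by apply: IH cn; apply: leq_trans Sm; rewrite [X in (_ < X)%N](cardsD1 v) vS.
have := arcs_setU1 (negbT (setD11 v S)); rewrite setD1K //.
have [deg1|] := leqP #|[set u in S :\ v | G v u]| 1.
  have : #|[set u in S :\ v | G v u]|%:R <= 1 :> R by rewrite lern1.
  rewrite cardS; lra.
case/card_gt1P => a [b [/setIdP[aS va] /setIdP[bS vb] ab]].
have vSv : v \notin S :\ v by rewrite setD11.
rewrite adj_sym in vb.
have [c uc c2] := connect_in_cycle vSv ab va vb aS (conn_connect cn aS bS).
by case: (acG c c2).
Qed.

(** A vertex [v] of a cycle has two neighbours in one component of the graph without [v], which
    yields one edge more than a tree can have. *)
Lemma arcs_acyclic : conn G setT -> arcs setT <= 2 * (#|T|%:R - 1) -> acyclic_graph G.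
Proof.
move=> cnT le c c2 uc.
case: c c2 uc => [//|v [//|a [//|d p]]] _; set q := d :: p.
rewrite /ucycle [cycle _ _]/= rcons_path => /andP[/and3P[va ad /andP[dp bv]] /andP[vq /andP[aq _]]].
have pq : path G a q by rewrite /= ad.
pose b := last a q.
have ab : a != b by apply: contraNneq aq => ->; rewrite /b /q /= mem_last.
(* [K] is the component of [a] after deleting [v]; it contains the rest of the cycle. *)
pose S := ~: [set v]; pose K := [set y | connect (adj_in S) a y].
have inS x : (x \in S) = (x != v) by rewrite !inE.
have av : a != v by apply: contraNneq vq => ->; rewrite mem_head.
have bK : b \in K.
  rewrite inE; apply/connectP; exists q => //.
  have aSq : all (mem S) (a :: q).
    by apply/allP => x xq; rewrite /= inS; apply: contraNneq vq => <-.
  have sub : {in S &, subrel G (adj_in S)} by move=> x y xS yS xy; apply/and3P.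
  exact: (sub_in_path sub aSq pq).
have aK : a \in K by rewrite inE connect0.
have vK : v \notin K.
  have clS : closed (adj_in S) S by move=> x y /and3P[-> ->].
  rewrite inE; apply/negP => /(closed_connect clS).
  by rewrite !inS av eqxx.
have Kout x y : x \in K -> y != v -> G x y -> y \in K.
  move=> xK yv xy.
  have xv : x != v by apply: contraNneq vK => <-.
  move: xK; rewrite !inE => ax; apply: connect_trans ax (connect1 _).
  by rewrite /adj_in /= !inS xv yv.
have cutT : cut G setT v K (~: (v |: K)).
  split=> //; first by apply/setP => x; rewrite !inE; case: eqP => //=; case: (connect _ _ _).
  - by rewrite !inE eqxx.
  - rewrite -setI_eq0; apply/eqP/setP => x; rewrite !inE.
    by case: (connect _ _ _); rewrite ?orbT ?andbF.
  move=> i j iK; rewrite !inE negb_or => /andP[jv]; apply: contra => ij.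
  by have := Kout i j iK jv ij; rewrite inE.
have cnK : conn G K.
  apply/connP; split; first by apply/set0Pn; exists a.
  move=> X /properP[XK [y yK yX]] /set0Pn[x xX].
  have [/exists_inP[u uX /exists_inP[w /setDP[wK wX] uw]]|nX] :=
    boolP [exists u in X, exists w in K :\: X, G u w].
    by exists u, w.
  have out u w : u \in X -> adj_in S u w -> w \in X.
    move=> uX uw; apply: contraR nX => wX; apply/exists_inP; exists u => //.
    apply/exists_inP; exists w; last by case/and3P: uw.
    rewrite in_setD wX inE /=; have := subsetP XK u uX; rewrite inE => au.
    exact: connect_trans au (connect1 uw).
  have clX : closed (adj_in S) X.
    by move=> u w uw; apply/idP/idP => /out; apply=> //; rewrite adj_in_sym.
  have xy : connect (adj_in S) x y.
    have := subsetP XK x xX; rewrite inE (sym_connect_sym (@adj_in_sym S)) => xa.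
    by apply: connect_trans xa _; rewrite inE in yK.
  by have := closed_connect clX xy; rewrite xX (negPf yX).
have : (1 < #|[set u in K | G v u]|)%N.
  apply/card_gt1P; exists a, b; split=> //; first by rewrite inE aK.
  by rewrite inE bK adj_sym.
rewrite -(ler_nat R) => deg2.
have := conn_arcs_ge cnK; have := conn_arcs_ge (cut_conn (cut_sym cutT) cnT).
have := arcs_setU1 vK; have := budget_cut R cutT; rewrite /budget.
have /(congr1 (fun n : nat => n%:R : R)) := cut_card cutT.
have cardK : #|v |: K|%:R = #|K|%:R + 1 :> R by rewrite cardsU1 vK natrD addrC.
(* [v |: K] has at least [2 (|K| - 1) + 4] arcs and the other side at least those of a tree, in
   total [2n], against the assumed [2 (n - 1)]. *)
rewrite natrD -[in RHS]natr1 cardK cardsT; move: le deg2; lra.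
Qed.

End Arcs.
End Trees.

(** * Positive and negative parts of the adjacency matrix *)

Lemma sum_enum_rank (V : nmodType) (T : finType) (f : 'I_#|T| -> V) :
  \sum_i f i = \sum_(x : T) f (enum_rank x).
Proof. by rewrite (reindex enum_rank) //; exact/onW_bij/enum_rank_bij. Qed.

Lemma parts_opp (R : realFieldType) (T : finType) (G : simple_graph T) (e : R) M N :
  e * e = 1 -> parts G e M N -> parts G (- e) N M.
Proof.
move=> ee p; split; [exact: parts_root' p|exact: parts_root p| |].
  by move=> i j; rewrite mulNr -(parts_adj p) opprB.
have [Z symZ NE] := parts_root' p.
have symN i j : N i j = N j i.
  by rewrite !NE; apply: eq_bigr => k _; rewrite mulrC symZ (symZ i).
move=> i j; rewrite -[RHS](parts_orth p j i); apply: eq_bigr => k _.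
by rewrite mulrC symN (parts_sym p).
Qed.

Lemma energy_parts (R : realType) (T : finType) (G : simple_graph T) :
  exists M N : T -> T -> R,
    [/\ parts G 1 M N, splus R G = energy M & sminus R G = energy N].
Proof.
set A := adjacency_matrix R G.
have symA : A^T = A by apply/matrixP => i j; rewrite !mxE adj_sym.
have [W [Z [symW symZ AE orth [trM trN]]]] := spectral_split symA.
pose F (B : 'M[R]_#|T|) (x y : T) := B (enum_rank x) (enum_rank y).
have FM B B' x y : F (B *m B') x y = \sum_z F B x z * F B' z y.
  by rewrite /F mxE sum_enum_rank.
have symF B x y : B^T = B -> F B x y = F B y x by move=> symB; rewrite /F -{1}symB mxE.
have trF B : B^T = B -> \tr (B *m B) = energy (F B).
  move=> symB; rewrite /mxtrace sum_enum_rank; apply: eq_bigr => x _.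
  by rewrite -/(F _ x x) FM; apply: eq_bigr => y _; rewrite expr2 [X in _ * X]symF.
exists (F (W *m W)), (F (Z *m Z)); split.
- split.
  + by exists (F W); [move=> i j; exact: symF|move=> i j; exact: FM].
  + by exists (F Z); [move=> i j; exact: symF|move=> i j; exact: FM].
  + move=> x y; transitivity (F A x y); last by rewrite /F mxE !enum_rankK mul1r.
    by rewrite AE /F !mxE.
  by move=> x y; rewrite -FM orth /F mxE.
- by rewrite /splus -/A -trM trF // trmx_mul symW.
- by rewrite /sminus -/A -trN trF // trmx_mul symZ.
Qed.

(** The cross term of [tr (M - N)^2] is a multiple of [tr (M N) = 0], and the entries of [A] are 0
    or 1. *)
Lemma energyD (R : realFieldType) (T : finType) (G : simple_graph T) (M N : T -> T -> R) :
  parts G 1 M N -> energy M + energy N = arcs R G setT.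
Proof.
move=> p; rewrite /arcs arc_sum_mkcond /energy -big_split.
apply: eq_big => [i|i _]; rewrite ?inE //.
have symN := parts_sym (parts_opp (mulr1 1) p).
rewrite -big_split /=.
transitivity (\sum_j (M i j ^+ 2 + N i j ^+ 2) - 2 * \sum_j M i j * N j i).
  by rewrite (parts_orth p) mulr0 subr0.
rewrite mulr_sumr -sumrB.
apply: eq_big => [j|j _]; rewrite ?inE // symN.
have := parts_adj p i j; rewrite mul1r => h.
rewrite (_ : _ - _ = (M i j - N i j) ^+ 2); last by rewrite (symN i j); ring.
by rewrite h; case: (G i j); rewrite ?expr1n ?expr0n.
Qed.

(** Testing [N] on the all-ones vector shows that the entries of [M] sum to at least [n (n - 1)];
    Cauchy-Schwarz against a constant matrix then bounds the energy. *)
Lemma energy_complete (R : realFieldType) (T : finType) (G : simple_graph T) (M N : T -> T -> R) :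
  parts G 1 M N -> complete_on G setT -> (0 < #|T|)%N -> (#|T|%:R - 1) ^+ 2 <= energy M.
Proof.
move=> p cT T0; set n : R := #|T|%:R.
have n0 : 0 < n by rewrite ltr0n.
(* The constant entry of the positive part of the adjacency matrix of the complete graph. *)
pose c := (n - 1) / n.
have sumN : 0 <= \sum_i \sum_j N i j.
  have [Z symZ NE] := parts_root' p.
  have -> : \sum_i \sum_j N i j = \sum_k (\sum_i Z i k) ^+ 2.
    under [RHS]eq_bigr => k _ do rewrite expr2 mulr_suml.
    rewrite [RHS]exchange_big; apply: eq_bigr => i _ /=.
    under [RHS]eq_bigr => k _ do rewrite mulr_sumr.
    rewrite [RHS]exchange_big; apply: eq_bigr => j _ /=.
    by rewrite NE; apply: eq_bigr => k _; rewrite (symZ j).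
  by apply: sumr_ge0 => k _; exact: sqr_ge0.
have sumM : n * (n - 1) <= \sum_i \sum_j M i j.
  have := arcs_complete R cT; rewrite cardsT -/n => <-.
  rewrite /arcs arc_sumT -subr_ge0 -sumrB.
  apply: le_trans sumN _; rewrite le_eqVlt; apply/orP; left; apply/eqP.
  apply: eq_bigr => i _; rewrite [X in _ - X]big_mkcond -sumrB; apply: eq_bigr => j _.
  have := parts_adj p i j; rewrite mul1r => h.
  by rewrite -[LHS](subKr (M i j)) h; case: (G i j).
have : 0 <= \sum_i \sum_j (M i j - c) ^+ 2.
  by apply: sumr_ge0 => i _; apply: sumr_ge0 => j _; exact: sqr_ge0.
have -> : \sum_i \sum_j (M i j - c) ^+ 2 =
    energy M - 2 * c * (\sum_i \sum_j M i j) + (n * c) ^+ 2.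
  rewrite (eq_bigr (fun i => \sum_j M i j ^+ 2 - 2 * c * (\sum_j M i j) + n * c ^+ 2)).
    rewrite big_split sumrB /= -mulr_sumr; congr (_ + _).
    by rewrite sumr_const -(mulr_natl _ #|T|) -/n; ring.
  move=> i _; rewrite mulr_sumr -sumrB (_ : n * c ^+ 2 = \sum_(j : T) c ^+ 2).
    by rewrite -big_split; apply: eq_bigr => j _ /=; ring.
  by rewrite sumr_const -(mulr_natl _ #|T|).
have -> : n * c = n - 1 by rewrite /c mulrC divfK // gt_eqF.
have c0 : 0 <= c.
  by rewrite divr_ge0 ?(ltW n0) // subr_ge0 ler1n.
have := ler_wpM2l c0 sumM.
have -> : c * (n * (n - 1)) = (n - 1) ^+ 2 by rewrite /c; field; rewrite gt_eqF.
by move=> h1 h2; lra.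
Qed.

Theorem theorem1p1 (R : realType) (T : finType) (G : simple_graph T) (n : nat)
    (cardT : #|T| = n) (connG : connected_graph G) :
  (splus R G = n%:R - 1 <-> is_tree G) /\
  (sminus R G = n%:R - 1 <-> is_tree G \/ is_complete G).
Proof.
have cnT := connected_conn connG.
have [T0 _] := connG.
have [M [N [p -> ->]]] := energy_parts R G.
have ee : 1 * 1 = 1 :> R := mulr1 1.
have p' := parts_opp ee p.
have ee' : - 1 * - 1 = 1 :> R by rewrite mulrNN mulr1.
have total := energyD p.
have leM := energy_le ee p cnT; have leN := energy_le ee' p' cnT.
have exM := energy_extremal ee p cnT; have exN := energy_extremal ee' p' cnT.
have comp := energy_complete p.
have arcsK := @arcs_complete R _ G setT.
have treeE : is_tree G <-> arcs R G setT <= 2 * (#|T|%:R - 1).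
  split=> [[_ acG]|le]; last by split=> //; exact: arcs_acyclic cnT le.
  by have := acyclic_arcs_le R acG cnT; rewrite cardsT.
have compE : is_complete G <-> complete_on G setT.
  split=> [cG|cG x y xy].
    by apply/forall_inP => x _; apply/forall_inP => y _; apply/implyP; exact: cG.
  have /forall_inP/(_ x)/(_ _)/forall_inP/(_ y)/(_ _)/implyP := cG.
  by apply; rewrite ?inE.
rewrite -cardT treeE compE; move: leM leN exM exN arcsK; rewrite /budget cardsT.
have n1 : 1 <= #|T|%:R :> R by rewrite ler1n.
set m := #|T|%:R in n1 comp *; set x := arcs R G setT in total *.
move=> leM leN exM exN arcsK.
split; split.
(* The energies add up to [x], so [eM] puts [energy N] at its budget. *)
- move=> eM; have [cT|->//] : complete_on G setT \/ x = 2 * (m - 1) by apply: exN; lra.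
  (* Here [(m - 1)^2 <= m - 1], so [m <= 2], and a complete graph of that order is a tree. *)
  by have := comp cT T0; have := arcsK cT; rewrite eM; nra.
(* Both energies are at least [m - 1] and their sum is at most [2 (m - 1)]. *)
- by move=> h; lra.
- move=> eN; have [cT|->] : complete_on G setT \/ x = 2 * (m - 1) by apply: exM; lra.
    by right.
  by left.
case=> [h|cT]; first by lra.
(* Of the total [m (m - 1)], at most [m - 1] is left for [energy N]; [leM] gives the reverse
   inequality. *)
by have := comp cT T0; have := arcsK cT; nra.
Qed.
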